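(* Let $m\ge 1$ be an integer with $\gcd(3,m)=1$, let $\Bbbk$ be a field, put $d_1=3$, $d_2=3+m$, $d_3=3+2m$, and let $T=\Bbbk[x_1,x_2,x_3]$ be graded by the weights $\operatorname{wt}(x_i)=d_i$. Let $\mathfrak p\subset T$ be the defining ideal of the monomial curve parametrized by $(t^{d_1},t^{d_2},t^{d_3})$. Then: (1) $\operatorname{reg}(T/\mathfrak p)=d_2+2d_3-2$. (2) Let $n\ge 2$. (a) If $m=1$, then $\operatorname{reg}(T/\mathfrak p^{(n)})=2d_2n-2d_2+3d_3-2$. (b) If $m=2$, then $\operatorname{reg}(T/\mathfrak p^{(n)})=\frac{3d_3}{2}n+4d_2-\frac{3d_3}{2}-2$ if $n$ is odd, and $\operatorname{reg}(T/\mathfrak p^{(n)})=\frac{3d_3}{2}n+2d_2-2$ if $n$ is even. (c) If $m\ge 3$, then $\operatorname{reg}(T/\mathfrak p^{(n)})=\frac{3d_3}{2}n+d_2+\frac{d_3}{2}-2$ if $n$ is odd, and $\operatorname{reg}(T/\mathfrak p^{(n)})=\frac{3d_3}{2}n+2d_2-2$ if $n$ is even. In particular, $\displaystyle\lim_{n\to\infty}\frac{\operatorname{reg}((\mathfrak p^{n})^{sat})}{n}=\frac{3\,e(T/\mathfrak p)}{2}+3m$.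
   Context: $\mathfrak p$ is the kernel of the $\Bbbk$-algebra map $T\to\Bbbk[t]$, $x_i\mapsto t^{d_i}$. Symbolic powers: $\mathfrak p^{(n)}=\mathfrak p^nT_{\mathfrak p}\cap T$; here $(\mathfrak p^n)^{sat}=\mathfrak p^{(n)}$ is the saturation of $\mathfrak p^n$ with respect to $(x_1,x_2,x_3)$. For a finitely generated graded $T$-module $M$ (weighted grading) with minimal graded free resolution $F_\bullet$, $F_i=\bigoplus_jT(-b_{ij})$, the regularity is $\operatorname{reg}(M)=\max_{i,j}\{b_{ij}-i\}$. $e(T/\mathfrak p)$ denotes the multiplicity of $T/\mathfrak p$ (localized at $(x_1,x_2,x_3)$), which equals $\ell(T/(\mathfrak p+(x_1)))=3$.
   Formalization: The final limit 3e(T/p)/2+3m is stated only for m≥2; for m=1 it is false (it gives 15/2, while part (2a) forces 2d_2=8), so for m=1 the limit is stated and proved as 2d_2. *)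

(* Defs.v *)
From HB Require Import structures.
From mathcomp Require Import all_boot all_order all_algebra.
(* mpoly must be loaded before mathcomp-analysis: in the other order the two
   libraries' notations are incompatible. *)
From mathcomp Require Import mpoly.
From mathcomp Require Import boolp classical_sets reals topology normedtype sequences.

Set Implicit Arguments.
Unset Strict Implicit.
Unset Printing Implicit Defensive.

Import Order.TTheory GRing.Theory Num.Theory.
Local Open Scope classical_set_scope.
Local Open Scope ring_scope.

Section Ideals.
Variable A : comNzRingType.
Implicit Types I J S : set A.

Definition is_ideal I : Prop :=
  [/\ I 0, forall f g, I f -> I g -> I (f + g) & forall a f, I f -> I (a * f)].

Definition ideal_gen S : set A := smallest is_ideal S.

Definition ideal_add I J : set A := ideal_gen (I `|` J).

Definition ideal_exp I (n : nat) : set A :=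
  ideal_gen [set f | exists u : 'I_n -> A,
                       (forall i, I (u i)) /\ f = \prod_(i < n) u i].

Definition saturation I J : set A :=
  [set f | exists N, forall g, ideal_exp J N g -> I (g * f)].

Definition has_chain I (l : nat) : Prop :=
  exists c : nat -> set A,
    [/\ forall i, (i <= l)%N -> is_ideal (c i),
        I `<=` c 0%N
      & forall i, (i < l)%N -> c i `<` c i.+1].

(* The length of the A-module A/I, i.e. the maximal length of a strict chain of
   ideals containing I; the default value is 0 when A/I has infinite length. *)
Definition colength I : nat :=
  xget 0%N [set l | has_chain I l /\ forall l', has_chain I l' -> (l' <= l)%N].

End Ideals.

(* P^n A_P `&` A, computed inside the fraction field of A; an element of
   P^n A_P is a fraction a / s with a in P^n and s outside P. *)
Definition symbolic_power (A : idomainType) (P : set A) (n : nat) : set A :=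
  [set f | exists a s : A, [/\ ideal_exp P n a, ~ P s & tofrac f = tofrac a / tofrac s]].

Section WeightedPolynomials.
Variables (k : fieldType) (r : nat).
Local Notation T := {mpoly k[r]}.

Definition vars_ideal : set T := ideal_gen (range (fun i : 'I_r => 'X_i)).

(* The defining ideal of the monomial curve (t^(d_1), ..., t^(d_r)). *)
Definition curve_ideal (d : 'I_r -> nat) : set T :=
  [set f | mmap (@polyC k) (fun i => 'X^(d i)) f = 0].

(* The length over the local ring T_m, m = (x_1, ..., x_r), of (T/I)_m / m^n is
   the length of T / (I + m^n) over T, since the latter module is already local. *)
Definition hilbert_samuel (I : set T) (n : nat) : nat :=
  colength (ideal_add I (ideal_exp vars_ideal n)).

(* The multiplicity of (T/I)_m, m = (x_1, ..., x_r): its Hilbert-Samuel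
   polynomial has degree D and leading coefficient e / D!. *)
Definition multiplicity (I : set T) : nat :=
  xget 0%N [set e | exists P : {poly rat},
    (exists N, forall n, (N <= n)%N -> P.[n%:R] = (hilbert_samuel I n)%:R) /\
    lead_coef P = e%:R / ((size P).-1)`!%:R].

Variable d : 'I_r -> nat.

Definition wdeg (u : 'X_{1..r}) : nat := (\sum_(i < r) u i * d i)%N.

(* The degree is an integer, so that this makes sense for the degree-e part of
   a twist T(-b), which is T_(e - b). *)
Definition whomog (e : int) (f : T) : Prop :=
  forall u, u \in msupp f -> (wdeg u)%:Z = e.

(* Data for ... -> F_1 -> F_0 -> T, where F_i is the direct sum of the
   T(-fc_twist i j) for j < fc_rank i. Elements of F_i are row vectors;
   F_(i+1) -> F_i is v |-> v *m fc_diff i, and fc_aug j is the image in T of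
   the j-th basis element of F_0. *)
Record free_complex := FreeComplex {
  fc_rank : nat -> nat;
  fc_twist : forall i, 'I_(fc_rank i) -> int;
  fc_diff : forall i, 'M[T]_(fc_rank i.+1, fc_rank i);
  fc_aug : 'I_(fc_rank 0) -> T }.

Definition fc_eps (F : free_complex) (v : 'rV[T]_(fc_rank F 0)) : T :=
  \sum_j v 0 j * fc_aug j.

Definition fc_graded (F : free_complex) : Prop :=
  (forall j, whomog (fc_twist j) (@fc_aug F j)) /\
  (forall i a b, whomog (fc_twist a - fc_twist b) (fc_diff F i a b)).

(* F is a free resolution of the subquotient I / J of T. *)
Definition fc_resolves (F : free_complex) (I J : set T) : Prop :=
  [/\ forall j, I (@fc_aug F j),
      forall f, I f -> exists v, J (f - @fc_eps F v),
      forall v, J (@fc_eps F v) <-> exists w, v = w *m fc_diff F 0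
    & forall i (v : 'rV_(fc_rank F i.+1)),
        v *m fc_diff F i = 0 <-> exists w, v = w *m fc_diff F i.+1].

Definition fc_minimal (F : free_complex) : Prop :=
  forall i a b, vars_ideal (fc_diff F i a b).

Definition minimal_graded_free_resolution (F : free_complex) (I J : set T) :=
  [/\ fc_graded F, fc_resolves F I J & fc_minimal F].

(* The regularity max_{i,j} (b_ij - i) of the graded T-module I / J, for
   homogeneous ideals J `<=` I of T. It does not depend on the choice of the
   minimal graded free resolution; the default value is 0. *)
Definition regularity (I J : set T) : int :=
  xget 0 [set e | exists F : free_complex,
    [/\ minimal_graded_free_resolution F I J,
        exists i (j : 'I_(fc_rank F i)), fc_twist j - i%:Z = e
      & forall i (j : 'I_(fc_rank F i)), fc_twist j - i%:Z <= e]].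

Definition reg_quotient (I : set T) : int := regularity setT I.

Definition reg_ideal (I : set T) : int := regularity I [set 0].

End WeightedPolynomials.

Arguments vars_ideal k r : clear implicits.
Arguments curve_ideal k {r} d.

(* Main.v *)
Require Import Defs.
From HB Require Import structures.
From mathcomp Require Import all_boot all_order all_algebra.
From mathcomp Require Import mpoly.
From mathcomp Require Import boolp classical_sets reals topology normedtype sequences.
From mathcomp Require Import ring lra zify.
Set Implicit Arguments.
Unset Strict Implicit.
Unset Printing Implicit Defensive.
Import Order.TTheory GRing.Theory Num.Theory.
Import numFieldNormedType.Exports.
Local Open Scope classical_set_scope.
Local Open Scope ring_scope.

(* With q = x1 ^ m, the prime p is generated by the minors cf1 = x2 ^ 2 - x1 x3,
   cf2 = x2 x3 - x1 ^ 2 q and cf3 = x3 ^ 2 - x1 x2 q, and there is one more form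
   Delta with (x1, x2, x3) Delta contained in p ^ 2. Put I_0 = T, I_1 = p and
   I_(n+2) = cf1 ^ (n+1) p + Delta I_n. Then p ^ n is contained in I_n,
   (x1, x2, x3) ^ n I_n is contained in p ^ n, and, by induction from the case of
   T / (cf1, Delta), every element outside p is regular on T / I_n; hence I_n is
   both the symbolic power and the saturation of p ^ n. The recursion yields the
   minimal free resolution of I_n, which has length one, and the twists of its
   relations give the regularity. That the regularity is well defined follows
   by comparing minimal resolutions: graded chain maps are mutually inverse
   modulo the maximal ideal, so the same twists occur. *)

(** The recursion comes from the identities a Delta = cf2^2 - cf1 cf3, b Delta = cf2 cf3 + q cf1^2
    and c Delta = cf3^2 + q cf1 cf2, with a, b, c for x1, x2, x3. Read modulo Delta, they turn every
    product of two generators of p into cf1 times an element of p, so only cf1^(n+1) p survives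
    beside the multiples of Delta. The summands of I_(n+2) meet exactly in the multiples of
    cf1^(n+1) Delta; hence its relations are those of p, those of I_n and one more, of degree 2 d2
    (n+1) + 3 d3. The top degree of a relation thus obeys r_(n+2) = 3 d3 + max (2 d2 (n+1), r_n),
    and the cases of the theorem are the cases of this maximum. The slopes to compare are 2 d2 and 3
    d3 / 2: 4 d2 <= 3 d3 exactly when m >= 2, so m = 1 has the limit 2 d2 = 8 and not 3 e / 2 + 3 m
    = 15 / 2. For odd n the start matters too: 4 d2 <= d2 + 2 d3 exactly when m >= 3, which sets m =
    2 apart. *)

(** * Generated ideals and their powers *)

Section IdealFacts.
Variable R : comNzRingType.
Implicit Types I J S : set R.

Lemma ideal_gen_sub S : S `<=` ideal_gen S.
Proof. by move=> x Sx J [_]; apply. Qed.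

Lemma ideal_gen_min S J : is_ideal J -> S `<=` J -> ideal_gen S `<=` J.
Proof. by move=> iJ SJ x; apply. Qed.

Lemma is_ideal_gen S : is_ideal (ideal_gen S).
Proof.
split=> [|f g Sf Sg|r f Sf] J [iJ SJ]; have [J0 JD JM] := iJ => //.
  by apply: JD; [apply: Sf | apply: Sg].
by apply: JM; apply: Sf.
Qed.

Lemma ideal_sum I (T : Type) (s : seq T) (P : pred T) (F : T -> R) :
  is_ideal I -> (forall i, P i -> I (F i)) -> I (\sum_(i <- s | P i) F i).
Proof. by case=> I0 ID IM IF; apply: (big_ind I). Qed.

Lemma ideal_opp I f : is_ideal I -> I f -> I (- f).
Proof. by case=> _ _ IM If; rewrite -mulN1r; apply: IM. Qed.

Lemma ideal_sub I f g : is_ideal I -> I f -> I g -> I (f - g).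
Proof. by move=> iI If Ig; case: (iI) => _ ID _; apply: ID => //; apply: ideal_opp. Qed.

Lemma ideal_expM I m n f g :
  ideal_exp I m f -> ideal_exp I n g -> ideal_exp I (m + n) (f * g).
Proof.
move=> If Ig.
have [e0 eD eM] := is_ideal_gen [set f | exists u : 'I_(m + n) -> R,
  (forall i, I (u i)) /\ f = \prod_(i < m + n) u i].
suff H : ideal_exp I m `<=` [set f | forall h, ideal_exp I n h ->
    ideal_exp I (m + n) (f * h)] by exact: H Ig.
apply: ideal_gen_min.
  split.
  - by move=> h _ /=; rewrite mul0r.
  - by move=> x y /= hx hy h Ih; rewrite mulrDl; apply: eD; [apply: hx | apply: hy].
  - by move=> a x /= hx h Ih; rewrite -mulrA; apply: eM; apply: hx.
move=> x [u [Iu ->]] /=; apply: ideal_gen_min.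
  split.
  - by rewrite /= mulr0.
  - by move=> y z /= hy hz; rewrite mulrDr; apply: eD.
  - by move=> a y /= hy; rewrite mulrCA; apply: eM.
move=> y [v [Iv ->]] /=; apply: ideal_gen_sub.
exists (fun i => match split i with inl j => u j | inr j => v j end); split.
  by move=> i; case: (split i).
rewrite big_split_ord /=; congr (_ * _); apply: eq_bigr => i _.
  by case: splitP => j /= e; [congr u; apply: val_inj | have := ltn_ord i; lia].
case: splitP => j /= e; first by have := ltn_ord j; lia.
by congr v; apply: val_inj; move/addnI: e.
Qed.

Lemma ideal_exp1 I f : I f -> ideal_exp I 1 f.
Proof. by move=> If; apply: ideal_gen_sub; exists (fun=> f); rewrite big_ord1. Qed.

Lemma ideal_exp0 I f : ideal_exp I 0 f.
Proof.
have [_ _ eM] := is_ideal_gen [set f | exists u : 'I_0 -> R,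
  (forall i, I (u i)) /\ f = \prod_(i < 0) u i].
rewrite -[f]mulr1; apply: eM; apply: ideal_gen_sub.
by exists (fun=> 0); rewrite big_ord0; split=> // -[].
Qed.

Lemma ideal_expX I n f : I f -> ideal_exp I n (f ^+ n).
Proof.
move=> If; elim: n => [|n IH]; first exact: ideal_exp0.
by rewrite exprS -add1n; apply: ideal_expM => //; apply: ideal_exp1.
Qed.

Lemma is_ideal_exp I n : is_ideal (ideal_exp I n).
Proof. exact: is_ideal_gen. Qed.

End IdealFacts.

Lemma nat_ind2 (P : nat -> Prop) :
  P 0%N -> P 1%N -> (forall n, P n -> P n.+2) -> forall n, P n.
Proof.
move=> P0 P1 PS n; suff: P n /\ P n.+1 by case.
by elim: n => [|n [? ?]]; split=> //; apply: PS.
Qed.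

(** * The recursive ideals I_n over an arbitrary domain *)

Section SymbolicPowers.
Variables (R : idomainType) (a b c q : R).

Definition cf1 : R := b ^+ 2 - a * c.
Definition cf2 : R := b * c - a ^+ 2 * q.
Definition cf3 : R := c ^+ 2 - a * b * q.
(* The extra generator of the second symbolic power: a * Delta, b * Delta and
   c * Delta are quadratic in cf1, cf2, cf3. *)
Definition Delta : R :=
  c ^+ 3 + q * b ^+ 3 - 3 * a * q * b * c + a ^+ 3 * q ^+ 2.

Lemma aDeltaE : a * Delta = cf2 ^+ 2 - cf1 * cf3.
Proof. rewrite /Delta /cf1 /cf2 /cf3; ring. Qed.
Lemma DeltaE : Delta = q * b * cf1 - a * q * cf2 + c * cf3.
Proof. rewrite /Delta /cf1 /cf2 /cf3; ring. Qed.

Definition curveJ : set R :=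
  [set f | exists u v w, f = u * cf1 + v * cf2 + w * cf3].

(** The recursion has step two because [Delta] counts as an element of the second symbolic power. *)
Fixpoint symb (n : nat) : set R :=
  match n with
  | 0 => setT
  | 1 => curveJ
  | n'.+2 => [set f | exists u v,
      [/\ curveJ u, symb n' v & f = cf1 ^+ n'.+1 * u + Delta * v]]
  end.

Lemma is_ideal_curveJ : is_ideal curveJ.
Proof.
split.
- by exists 0, 0, 0; ring.
- move=> f g [u [v [w ->]]] [u' [v' [w' ->]]].
  by exists (u + u'), (v + v'), (w + w'); ring.
- by move=> r f [u [v [w ->]]]; exists (r * u), (r * v), (r * w); ring.
Qed.

Lemma is_ideal_symb n : is_ideal (symb n).
Proof.
elim/nat_ind2: n => [||n [I0 ID IM]]; first by split.
  exact: is_ideal_curveJ.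
have [J0 JD JM] := is_ideal_curveJ.
split=> [|f g [u [v [Ju Iv ->]]] [u' [v' [Ju' Iv' ->]]]|r f [u [v [Ju Iv ->]]]].
- by exists 0, 0; split=> //; ring.
- by exists (u + u'), (v + v'); split; [exact: JD | exact: ID | ring].
- by exists (r * u), (r * v); split; [exact: JM | exact: IM | ring].
Qed.

Lemma curveJ1 : curveJ cf1. Proof. by exists 1, 0, 0; ring. Qed.
Lemma curveJ2 : curveJ cf2. Proof. by exists 0, 1, 0; ring. Qed.
Lemma curveJ3 : curveJ cf3. Proof. by exists 0, 0, 1; ring. Qed.
Lemma curveJ_Delta : curveJ Delta.
Proof. by exists (q * b), (- (a * q)), c; rewrite DeltaE; ring. Qed.

Lemma symb_cf1X n : symb n (cf1 ^+ n).
Proof.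
case: n => [|[|n]] //; first by rewrite expr1; exact: curveJ1.
exists cf1, 0; rewrite exprSr mulr0 addr0; split=> //; first exact: curveJ1.
by have [] := is_ideal_symb n.
Qed.

Lemma symb_Delta n f : symb n f -> symb n.+2 (Delta * f).
Proof.
by move=> If; exists 0, f; split=> //; [have [] := is_ideal_curveJ | ring].
Qed.

End SymbolicPowers.

(** * Regular elements modulo I_n; I_n as symbolic power and as saturation *)

Section Regular.
Variables (R : idomainType) (a b c q : R).
Local Notation f1 := (cf1 a b c).
Local Notation f2 := (cf2 a b c q).
Local Notation f3 := (cf3 a b c q).
Local Notation D := (Delta a b c q).
Local Notation J := (curveJ a b c q).
Local Notation I := (symb a b c q).

Hypothesis f1_prime :
  forall x y z, x * y = f1 * z -> (exists t, x = f1 * t) \/ (exists t, y = f1 * t).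
Hypothesis f1_neq0 : f1 != 0.
Hypothesis f1_ndvd_f2 : forall t, f2 <> f1 * t.
Hypothesis ab_regular : forall x y, a * x + b * y = 0 ->
  exists s, x = b * s /\ y = - (a * s).
Hypothesis abc_regular : forall w x y, w * c ^+ 2 = a * x + b * y ->
  exists x' y', w = a * x' + b * y'.
Hypothesis J_prime : forall x y, J (x * y) -> J x \/ J y.
Hypothesis nJa : ~ J a.

Lemma f1_dvd_mulf2 y z : y * f2 = f1 * z -> exists t, y = f1 * t.
Proof. by move=> /f1_prime[//|[t /f1_ndvd_f2]]. Qed.

(** Modulo [f1], [a * D] is the square of [f2]; so if the prime [f1] divided [D], it would divide
    [f2]. *)
Lemma f1_dvd_mulDelta y z : y * D = f1 * z -> exists t, y = f1 * t.
Proof.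
move=> /f1_prime[//|[t Dt]].
have /f1_prime[[s /f1_ndvd_f2]|[s /f1_ndvd_f2]] //: f2 * f2 = f1 * (a * t + f3).
have -> : f2 * f2 = a * D + f1 * f3 by rewrite aDeltaE; ring.
by rewrite Dt; ring.
Qed.

Lemma f1X_dvd_mulDelta n y z : D * y = f1 ^+ n * z -> exists t, y = f1 ^+ n * t.
Proof.
elim: n y z => [|n IH] y z; first by exists y; rewrite mul1r.
rewrite exprS -mulrA mulrC => e.
have [t yt] := f1_dvd_mulDelta e.
have [|s ts] := IH t z; last by exists s; rewrite yt ts mulrA.
by apply: (mulfI f1_neq0); rewrite -e yt; ring.
Qed.

Lemma Delta_neq0 : D != 0.
Proof.
apply/eqP=> D0; have [t t1] : exists t, 1 = f1 * t.
  by apply: (@f1_dvd_mulDelta 1 0); rewrite D0; ring.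
by apply: (f1_ndvd_f2 (t := t * f2)); rewrite mulrA -t1 mul1r.
Qed.

(** Elimination: since [c * f1 - b * f2 + a * f3 = 0], multiplying by [a] removes [f3] and shows
    that [f1] divides [(a * v + b * w) * f2]. Once [a * v + b * w = f1 * t], the pair [v + c * t],
    [w - b * t] is a relation of the regular pair [a], [b], and [u] follows by cancelling [f1]. *)
Lemma curve_syzygy u v w : u * f1 + v * f2 + w * f3 = 0 ->
  exists s t, [/\ u = t * c + s * (a * q), v = - (t * b) - s * c & w = t * a + s * b].
Proof.
move=> e; have [|t et] := @f1_dvd_mulf2 (a * v + b * w) (c * w - a * u).
  have -> : (a * v + b * w) * f2 = f1 * (c * w - a * u)
      + a * (u * f1 + v * f2 + w * f3) by rewrite /cf1 /cf2 /cf3; ring.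
  by rewrite e mulr0 addr0.
have [|s [vs ws]] := @ab_regular (v + c * t) (w - b * t).
  have -> : a * (v + c * t) + b * (w - b * t) = a * v + b * w - f1 * t.
    by rewrite /cf1; ring.
  by rewrite et subrr.
have {}vs : v = b * s - c * t by rewrite -vs; ring.
have {}ws : w = b * t - a * s by rewrite -[w](subrK (b * t)) ws; ring.
exists t, (- s); split; [|by rewrite vs; ring|by rewrite ws; ring].
apply: (mulfI f1_neq0); apply: subr0_eq; rewrite -e vs ws /cf1 /cf2 /cf3; ring.
Qed.

Definition f1D : set R := [set y | exists u v, y = f1 * u + D * v].

Lemma f1D_curveJ y : f1D y -> J y.
Proof.
have [_ JD JM] := is_ideal_curveJ a b c q.
case=> u [v ->]; rewrite mulrC [D * v]mulrC.
by apply: JD; apply: JM; [exact: curveJ1 | exact: curveJ_Delta].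
Qed.

Lemma f1D_add x y : f1D x -> f1D y -> f1D (x + y).
Proof. by case=> u [v ->] [u' [v' ->]]; exists (u + u'), (v + v'); ring. Qed.

(** This embeds J / (f1, D) into R / J by sending f2 to a and f3 to b, so that J / (f1, D) is
    torsion-free over R / J. Modulo [f1] one has [a * f3 = b * f2] and [a * D = f2 ^+ 2];
    multiplying [v * f2 + w * f3] by [a] therefore gives [(a * v + b * w) * f2], where [f2] can be
    cancelled. *)
Lemma f1D_mem v w : f1D (v * f2 + w * f3) <-> J (a * v + b * w).
Proof.
split=> [[x [y e]]|[u1 [u2 [u3 e]]]].
  have [|t et] := @f1_dvd_mulf2 (a * v + b * w - y * f2) (c * w + a * x - y * f3).
    have -> : (a * v + b * w - y * f2) * f2 = f1 * (c * w + a * x - y * f3)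
        + a * (v * f2 + w * f3 - (f1 * x + D * y)).
      by rewrite /Delta /cf1 /cf2 /cf3; ring.
    by rewrite e subrr mulr0 addr0.
  exists t, y, 0; rewrite -[LHS](subrK (y * f2)) et; ring.
(* Modulo [a] and [b], [f1] and [f2] vanish and [f3] becomes [c ^+ 2], so [u3] lies in the ideal of
   [a] and [b]; what remains is a relation between [a] and [b], solved for [v] and [w]. *)
have [|x [y u3E]] := @abc_regular u3 (v - u2 * (- (a * q)) + u1 * c + u3 * b * q)
    (w - u1 * b - u2 * c).
  apply: subr0_eq; rewrite (_ : _ - _ = u1 * f1 + u2 * f2 + u3 * f3 - (a * v + b * w)).
    by rewrite e subrr.
  by rewrite /cf1 /cf2 /cf3; ring.
have e2 : a * (v + u2 * a * q + u1 * c - x * f3) + b * (w - u1 * b - u2 * c - y * f3) = 0.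
  have -> : a * (v + u2 * a * q + u1 * c - x * f3)
      + b * (w - u1 * b - u2 * c - y * f3) = a * v + b * w
     - (u1 * f1 + u2 * f2 + (a * x + b * y) * f3) by rewrite /cf1 /cf2 /cf3; ring.
  by rewrite -u3E e subrr.
have [s [vs ws]] := ab_regular e2.
have {}vs : v = b * s - u2 * a * q - u1 * c + x * f3 by rewrite -vs; ring.
have {}ws : w = - (a * s) + u1 * b + u2 * c + y * f3 by rewrite -ws; ring.
exists (s * c - u1 * (a * q) - u2 * q * b - x * q * f1 - y * q * f2),
  (u2 + x * b + y * c).
by rewrite vs ws /Delta /cf1 /cf2 /cf3; ring.
Qed.

Lemma f1D_regular s y : ~ J s -> f1D (s * y) -> f1D y.
Proof.
move=> nJs sy; have [//|[u [v [w yE]]]] := J_prime (f1D_curveJ sy).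
have : f1D ((s * v) * f2 + (s * w) * f3).
  rewrite (_ : _ + _ = s * y + (f1 * (- (s * u)) + D * 0)); last by rewrite yE; ring.
  by apply: f1D_add => //; exists (- (s * u)), 0.
move=> /f1D_mem; rewrite (_ : _ + _ = s * (a * v + b * w)); last by ring.
move=> /J_prime[//|/f1D_mem]; rewrite yE -addrA => vw.
by apply: f1D_add => //; exists u, 0; ring.
Qed.

(** The exponent drops by one at a time: with [y = f1 * x + D * z], comparing both expressions of
    [s * y] shows that [f1] divides [D * (s * z - v)], hence [s * z - v]. After cancelling [f1], [x]
    satisfies the same kind of equation with [n] for [n.+1]. *)
Lemma f1XD_regular n s y u v : ~ J s -> s * y = f1 ^+ n * u + D * v ->
  exists u' v', y = f1 ^+ n * u' + D * v'.
Proof.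
move=> nJs; elim: n y u v => [|n IH] y u v e; first by exists y, 0; ring.
have [|x [z yE]] := @f1D_regular s y nJs.
  by exists (f1 ^+ n * u), v; rewrite e exprS mulrA.
have [|t tE] := @f1_dvd_mulDelta (s * z - v) (f1 ^+ n * u - s * x).
  rewrite mulrBr mulrA -exprS mulrC mulrBr; apply: subr0_eq.
  have -> : D * (s * z) - D * v - (f1 ^+ n.+1 * u - f1 * (s * x))
    = s * (f1 * x + D * z) - (f1 ^+ n.+1 * u + D * v) by ring.
  by rewrite -yE e subrr.
have [|x' [z' xE]] := IH x u (- t).
  apply: (mulfI f1_neq0); apply: subr0_eq.
  have -> : f1 * (s * x) - f1 * (f1 ^+ n * u + D * (- t))
    = (s * y) - (f1 ^+ n.+1 * u + D * v) - D * (s * z - v - f1 * t).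
    by rewrite yE exprS; ring.
  by rewrite e tE !subrr mulr0 subrr.
by exists x', (f1 * z' + z); rewrite yE xE exprS; ring.
Qed.

(** The coordinates in [f1 ^+ n.+1 * u + D * v] are unique up to adding [D * w] to [u] and
    subtracting [f1 ^+ n.+1 * w] from [v]. Such corrections stay in [J] and in [I n], so [s * u']
    and [s * v'] lie there, and [s] is cancelled in each separately. *)
Lemma symb_regular n s y : ~ J s -> I n (s * y) -> I n y.
Proof.
move=> nJs; elim/nat_ind2: n y => [//|y /J_prime[]//|n IH y [u [v [Ju Iv e]]]].
have [u' [v' yE]] := f1XD_regular nJs e.
have [|w wE] := @f1X_dvd_mulDelta n.+1 (v - s * v') (s * u' - u).
  apply: subr0_eq; rewrite mulrBr mulrBr.
  have -> : D * v - D * (s * v') - (f1 ^+ n.+1 * (s * u') - f1 ^+ n.+1 * u)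
    = f1 ^+ n.+1 * u + D * v - s * (f1 ^+ n.+1 * u' + D * v') by ring.
  by rewrite -e yE subrr.
have [_ ID IM] := is_ideal_symb a b c q n.
have [_ JD JM] := is_ideal_curveJ a b c q.
exists u', v'; split=> //.
  have /J_prime[]// : J (s * u').
  have -> : s * u' = u + D * w.
    apply: (mulfI (expf_neq0 n.+1 f1_neq0)); apply: subr0_eq.
    have -> : f1 ^+ n.+1 * (s * u') - f1 ^+ n.+1 * (u + D * w)
      = s * (f1 ^+ n.+1 * u' + D * v') - (f1 ^+ n.+1 * u + D * v)
        + D * (v - s * v' - f1 ^+ n.+1 * w) by ring.
    by rewrite -yE e wE !subrr mulr0 addr0.
  by apply: JD => //; rewrite mulrC; apply: JM; exact: curveJ_Delta.
apply: IH; rewrite (_ : s * v' = v - f1 ^+ n.+1 * w); last by rewrite -wE; ring.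
apply: ideal_sub => //; first exact: is_ideal_symb.
by rewrite mulrC exprS mulrA; apply: IM; exact: symb_cf1X.
Qed.

(* As J ^ 2 is contained in f1 * J + (Delta). *)
Lemma curveJ_mul f g : J f -> J g -> exists h x, J h /\ f * g = f1 * h + D * x.
Proof.
move=> [u [v [w ->]]] [u' [v' [w' ->]]].
exists (u * (u' * f1 + v' * f2 + w' * f3) + u' * (v * f2 + w * f3)
    + (v * v') * f3 - (v * w' + v' * w) * q * f1 - w * w' * q * f2),
  (a * (v * v') + b * (v * w' + v' * w) + c * (w * w')).
split.
  exists (u * u' - (v * w' + v' * w) * q), (u * v' + u' * v - w * w' * q),
    (u * w' + u' * w + v * v'); ring.
by rewrite /Delta /cf1 /cf2 /cf3; ring.
Qed.

(** Writing [f * u] as [f1 * h + D * x] leaves the stray term [D * (f1 ^+ n.+1 * x)]; it is absorbed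
    because [f1 ^+ n.+1] lies in [I n.+1]. *)
Lemma curveJ_mul_symb n f g : J f -> I n g -> I n.+1 (f * g).
Proof.
move=> Jf; have [_ JD JM] := is_ideal_curveJ a b c q.
elim/nat_ind2: n g => [g _|g Jg|n IH g [u [v [Ju Iv ->]]]].
- by rewrite mulrC; apply: JM.
- have [h [x [Jh ->]]] := curveJ_mul Jf Jg.
  by exists h, x; split; rewrite ?expr1.
have [_ ID _] := is_ideal_symb a b c q n.+3.
rewrite mulrDr [f * (D * v)]mulrCA; apply: ID; last by apply: symb_Delta; apply: IH.
have [h [x [Jh e]]] := curveJ_mul Jf Ju.
rewrite mulrCA e mulrDr mulrCA; exists h, (f1 ^+ n.+1 * x); split=> //.
  rewrite mulrC; have [_ _ IM] := is_ideal_symb a b c q n.+1.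
  by apply: IM; apply: symb_cf1X.
by rewrite [f1 ^+ n.+2]exprS; ring.
Qed.

Lemma curveJ_exp_symb n : ideal_exp J n `<=` I n.
Proof.
apply: ideal_gen_min; first exact: is_ideal_symb.
move=> _ [u [Ju ->]]; elim: n u Ju => [//|n IH] u Ju.
by rewrite big_ord_recl; apply: curveJ_mul_symb => //; apply: IH.
Qed.

(** Each factor [D] consumes one [u i] and becomes an element of the square of [J]. The set [M] is a
    parameter so as to serve both the powers of [a] alone, for symbolic powers, and the whole ideal
    of the variables, for the saturation. *)
Lemma symb_exp_curveJ (M : set R) n N f (u : 'I_N -> R) :
  (n <= N)%N -> (forall g, M g -> ideal_exp J 2 (D * g)) -> (forall i, M (u i)) ->
  I n f -> ideal_exp J n (f * \prod_(i < N) u i).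
Proof.
move=> nN MD; elim/nat_ind2: n N f u nN => [N f u _ _ _|N f u _ _ Jf|n IH N f u nN Mu].
- exact: ideal_exp0.
- by have [_ _ eM] := is_ideal_exp J 1; rewrite mulrC; apply: eM; apply: ideal_exp1.
case=> x [y [Jx Iy ->]]; rewrite mulrDl.
have [_ eD eM] := is_ideal_exp J n.+2; apply: eD.
  rewrite mulrC; apply: eM; rewrite -addn1; apply: ideal_expM.
    by apply: ideal_expX; apply: curveJ1.
  exact: ideal_exp1.
case: N nN u Mu => [|N] // nN u Mu.
rewrite big_ord_recl mulrACA -[n.+2]add2n; apply: ideal_expM; first by apply: MD; apply: Mu.
by apply: IH => //; exact: ltnW.
Qed.

Lemma mDelta_expJ g : (exists x y z, g = x * a + y * b + z * c) ->
  ideal_exp J 2 (D * g).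
Proof.
have [_ eD eM] := is_ideal_exp J 2.
have J2 x y : J x -> J y -> ideal_exp J 2 (x * y).
  by move=> Jx Jy; apply: (@ideal_expM _ _ 1 1); apply: ideal_exp1.
have J_f1 := curveJ1 a b c q; have J_f2 := curveJ2 a b c q; have J_f3 := curveJ3 a b c q.
move=> [x [y [z ->]]].
have -> : D * (x * a + y * b + z * c) = x * (f2 * f2) + (- x) * (f1 * f3)
  + y * (f2 * f3) + (y * q) * (f1 * f1) + z * (f3 * f3) + (z * q) * (f1 * f2).
  by rewrite /Delta /cf1 /cf2 /cf3; ring.
by do 5 ?[apply: (eD); last by apply: (eM); apply: J2]; apply: (eM); apply: J2.
Qed.

Lemma nJaX n : ~ J (a ^+ n).
Proof.
have [_ _ JM] := is_ideal_curveJ a b c q.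
elim: n => [J1|n IH]; last by rewrite exprS => /J_prime[].
by apply: nJa; have := JM a _ J1; rewrite mulr1.
Qed.

Lemma symbolic_power_symb n : symbolic_power J n = I n.
Proof.
have [J0 _ _] := is_ideal_curveJ a b c q.
apply/seteqP; split=> f /=.
  move=> [x [s [Jx nJs e]]].
  have s0 : s != 0 by apply/eqP => s0; apply: nJs; rewrite s0.
  apply: (symb_regular nJs); apply: curveJ_exp_symb.
  have -> // : s * f = x.
  by apply/eqP; rewrite -tofrac_eq tofracM e mulrC divfK // tofrac_eq0.
(* One denominator serves all of [I n]: [a * D] lies in the square of [J], and primeness keeps
   [a ^+ n] outside [J]. *)
move=> If; exists (f * a ^+ n), (a ^+ n); split; last 1 first.
- by rewrite tofracM mulfK // tofrac_eq0; apply/eqP => a0; apply: (nJaX (n := n)); rewrite a0.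
- rewrite -[n in a ^+ n]card_ord -prodr_const.
  apply: (@symb_exp_curveJ [set a]) => // _ -> /=; apply: mDelta_expJ.
  by exists 1, 0, 0; ring.
exact: nJaX.
Qed.

Lemma saturation_symb (M : set R) n :
  (forall g, M g <-> exists x y z, g = x * a + y * b + z * c) ->
  saturation (ideal_exp J n) M = I n.
Proof.
move=> ME; have Ma : M a by apply/ME; exists 1, 0, 0; ring.
apply/seteqP; split=> f /=.
  case=> N /(_ _ (@ideal_expX _ M N a Ma)) /curveJ_exp_symb.
  exact: symb_regular (@nJaX N).
move=> If; exists n => g Mg.
suff: ideal_exp M n `<=` [set g | ideal_exp J n (g * f)] by apply.
have [e0 eD eM] := is_ideal_exp J n.
apply: ideal_gen_min => [|_ [u [Mu ->]] /=].
  split=> /= [|x y Jx Jy|r x Jx]; first by rewrite mul0r.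
    by rewrite mulrDl; apply: eD.
  by rewrite -mulrA; apply: eM.
rewrite mulrC; apply: (@symb_exp_curveJ M) => // x /ME; exact: mDelta_expJ.
Qed.

End Regular.

(** * Generators and relations of I_n *)

Section Generators.
Variables (R : idomainType) (a b c q : R).
Local Notation f1 := (cf1 a b c).
Local Notation f2 := (cf2 a b c q).
Local Notation f3 := (cf3 a b c q).
Local Notation D := (Delta a b c q).

Fixpoint ngens (n : nat) : nat :=
  match n with 0 => 1 | 1 => 3 | n'.+2 => 3 + ngens n' end.

Fixpoint nrels (n : nat) : nat :=
  match n with 0 => 0 | 1 => 2 | n'.+2 => 3 + nrels n' end.

Definition curve_gens : 'cV[R]_3 := \col_i [:: f1; f2; f3]`_i.

Definition curve_rels : 'M[R]_(2, 3) :=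
  \matrix_(i, j) (nth [::] [:: [:: c; - b; a]; [:: a * q; - c; b]] i)`_j.

(** The Hilbert-Burch matrix [curve_rels], whose minors are f1, f2, f3 up to sign, bordered by the
    coordinates of [Delta] from [DeltaE]; the determinant is [- Delta]. *)
Definition curve_rels_Delta : 'M[R]_3 :=
  \matrix_(i, j) (nth [::] [:: [:: c; - b; a]; [:: a * q; - c; b];
                              [:: q * b; - (a * q); c]] i)`_j.

Fixpoint gens (n : nat) : 'cV[R]_(ngens n) :=
  match n with
  | 0 => const_mx 1
  | 1 => curve_gens
  | n'.+2 => col_mx (f1 ^+ n'.+1 *: curve_gens) (D *: gens n')
  end.

(* The coordinates of cf1 ^+ n in the generators of the n-th symbolic power. *)
Fixpoint cf1X_coord (n : nat) : 'rV[R]_(ngens n) :=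
  match n with
  | 0 => const_mx 1
  | 1 => delta_mx 0 0
  | n'.+2 => row_mx (delta_mx 0 0 : 'rV_3) 0
  end.

(* The third row of the new block expresses that cf1 ^+ n.+1 * Delta, which is
   a combination of the three new generators, is also Delta times an element
   of the n-th symbolic power. *)
Fixpoint rels (n : nat) : 'M[R]_(nrels n, ngens n) :=
  match n with
  | 0 => 0
  | 1 => curve_rels
  | n'.+2 => block_mx curve_rels_Delta
      (\matrix_(i < 3, j < ngens n') (- ((i == 2%N :> nat)%:R * f1 * cf1X_coord n' 0 j)))
      0 (rels n')
  end.

Definition i0 : 'I_3 := ord0.
Definition i1 : 'I_3 := lift ord0 ord0.
Definition i2 : 'I_3 := lift ord0 (lift ord0 ord0).

Definition row3 (x y z : R) : 'rV[R]_3 := \row_j [:: x; y; z]`_j.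

Lemma row3E x y z : (row3 x y z 0 i0 = x) * (row3 x y z 0 i1 = y) * (row3 x y z 0 i2 = z).
Proof. by rewrite !mxE. Qed.

Lemma row3_eq (u v : 'rV[R]_3) :
  u 0 i0 = v 0 i0 -> u 0 i1 = v 0 i1 -> u 0 i2 = v 0 i2 -> u = v.
Proof.
move=> e0 e1 e2; apply/rowP; case=> [[|[|[|//]]] lt].
- by rewrite (_ : Ordinal lt = i0) //; apply: val_inj.
- by rewrite (_ : Ordinal lt = i1) //; apply: val_inj.
- by rewrite (_ : Ordinal lt = i2) //; apply: val_inj.
Qed.

Definition geval n (v : 'rV[R]_(ngens n)) : R := (v *m gens n) 0 0.

Lemma geval0 (v : 'rV[R]_1) : @geval 0 v = v 0 0.
Proof. by rewrite /geval mxE big_ord1 mxE mulr1. Qed.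

Lemma geval1 (v : 'rV[R]_3) : @geval 1 v = v 0 i0 * f1 + v 0 i1 * f2 + v 0 i2 * f3.
Proof. by rewrite /geval mxE !big_ord_recl big_ord0 !mxE /= addr0 !addrA. Qed.

Lemma gevalSS n (u : 'rV[R]_3) (v : 'rV[R]_(ngens n)) :
  @geval n.+2 (row_mx u v) = f1 ^+ n.+1 * @geval 1 u + D * geval v.
Proof. by rewrite /geval mul_row_col -!scalemxAr mxE; congr (_ + _); rewrite mxE. Qed.

Lemma gevalBZ n (u v : 'rV[R]_(ngens n)) x : geval (u - x *: v) = geval u - x * geval v.
Proof.
by rewrite /geval mulmxBl -scalemxAl mxE; congr (_ + _); rewrite mxE; congr (- _); rewrite mxE.
Qed.

Lemma geval_cf1X n : geval (cf1X_coord n) = f1 ^+ n.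
Proof.
case: n => [|[|n]] /=; first by rewrite geval0 mxE.
- by rewrite geval1 !mxE /=; ring.
have e0 : geval (0 : 'rV_(ngens n)) = 0 by rewrite /geval mul0mx mxE.
rewrite gevalSS e0 geval1 !mxE /= [f1 ^+ n.+2]exprS; ring.
Qed.

Lemma symb_gevalP n f : symb a b c q n f <-> exists v : 'rV_(ngens n), f = geval v.
Proof.
elim/nat_ind2: n f => [f|f|n IH f].
- by split=> // _; exists (const_mx f); rewrite geval0 mxE.
- split=> [[u [v [w ->]]]|[v ->]].
    by exists (row3 u v w); rewrite geval1 !row3E.
  by exists (v 0 i0), (v 0 i1), (v 0 i2); rewrite geval1.
split=> [[x [y [[u [v [w ->]]] /IH[z ->] ->]]]|[v ->]].
  by exists (row_mx (row3 u v w) z); rewrite gevalSS geval1 !row3E.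
rewrite -[v]hsubmxK gevalSS.
exists (@geval 1 (lsubmx v : 'rV_3)), (geval (rsubmx v)); split=> //.
  by rewrite geval1; exists (lsubmx v 0 i0), (lsubmx v 0 i1), (lsubmx v 0 i2).
by apply/IH; exists (rsubmx v).
Qed.

Lemma mul_curve_rels (w : 'rV[R]_2) (x := w 0 0) (y := w 0 1) :
  w *m curve_rels = row3 (x * c + y * (a * q)) (- (x * b) - y * c) (x * a + y * b).
Proof.
by apply: row3_eq; rewrite row3E !mxE !big_ord_recl big_ord0 !mxE /= addr0
  (_ : lift ord0 ord0 = 1) ?mulrN //; apply: val_inj.
Qed.

Lemma mul_curve_rels_Delta (w : 'rV[R]_3) (x := w 0 i0) (y := w 0 i1) (z := w 0 i2) :
  w *m curve_rels_Delta = row3 (x * c + y * (a * q) + z * (q * b))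
    (- (x * b) - y * c - z * (a * q)) (x * a + y * b + z * c).
Proof.
by apply: row3_eq; rewrite row3E !mxE !big_ord_recl big_ord0 !mxE /= addr0 ?mulrN addrA.
Qed.

Lemma mul_corner n (u : 'rV[R]_3) :
  u *m (\matrix_(i < 3, j < ngens n) (- ((i == 2%N :> nat)%:R * f1 * cf1X_coord n 0 j)))
  = - (u 0 i2 * f1) *: cf1X_coord n.
Proof.
apply/rowP=> j; rewrite mxE !big_ord_recl big_ord0 !mxE /=.
by rewrite !mul0r oppr0 !mulr0 !add0r addr0 mul1r mulrN mulrA mulNr.
Qed.

Lemma mul_relsSS n (u : 'rV[R]_3) (v : 'rV[R]_(nrels n)) :
  row_mx u v *m rels n.+2
  = row_mx (u *m curve_rels_Delta) (v *m rels n - (u 0 i2 * f1) *: cf1X_coord n).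
Proof.
by rewrite /= mul_row_block mulmx0 addr0 mul_corner scaleNr addrC.
Qed.

Lemma geval_rels n (w : 'rV[R]_(nrels n)) : geval (w *m rels n) = 0.
Proof.
elim/nat_ind2: n w => [w|w|n IH w].
- by rewrite mulmx0 geval0 mxE.
- rewrite mul_curve_rels geval1 !row3E /cf1 /cf2 /cf3; ring.
rewrite -[w]hsubmxK mul_relsSS gevalSS mul_curve_rels_Delta geval1 !row3E.
rewrite gevalBZ IH geval_cf1X sub0r exprS /cf1 /cf2 /cf3 /Delta; ring.
Qed.

Hypothesis f1_prime :
  forall x y z, x * y = f1 * z -> (exists t, x = f1 * t) \/ (exists t, y = f1 * t).
Hypothesis f1_neq0 : f1 != 0.
Hypothesis f1_ndvd_f2 : forall t, f2 <> f1 * t.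
Hypothesis ab_regular : forall x y, a * x + b * y = 0 ->
  exists s, x = b * s /\ y = - (a * s).

(** In a relation, [D * geval y] is a multiple of [f1 ^+ n.+1], so [geval y = f1 ^+ n.+1 * z].
    Adding [z] times the third new row splits the relation into one among the generators of I_n and
    one among f1, f2, f3. *)
Lemma geval_eq0 n (v : 'rV[R]_(ngens n)) : geval v = 0 ->
  exists w, v = w *m rels n.
Proof.
elim/nat_ind2: n v => [v|v|n IH v].
- by rewrite geval0 => v0; exists 0; apply/rowP=> j; rewrite mulmx0 ord1 v0 mxE.
- rewrite geval1 => /(curve_syzygy f1_prime f1_neq0 f1_ndvd_f2 ab_regular)[s [t [e0 e1 e2]]].
  exists (\row_i [:: t; s]`_i); rewrite mul_curve_rels !mxE /=.
  by apply: row3_eq; rewrite row3E.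
rewrite -[v]hsubmxK; move: (lsubmx v) (rsubmx v) => {v} x y.
rewrite gevalSS => e.
have [|z yE] := @f1X_dvd_mulDelta R a b c q f1_prime f1_neq0 f1_ndvd_f2 n.+1 (geval y)
    (- @geval 1 x).
  by apply: subr0_eq; rewrite -e; ring.
have [|w wE] := IH (y - (z * f1) *: cf1X_coord n).
  rewrite gevalBZ geval_cf1X yE exprS; ring.
have [] := @curve_syzygy R a b c q f1_prime f1_neq0 f1_ndvd_f2 ab_regular
    (x 0 i0 + z * (q * b)) (x 0 i1 - z * (a * q)) (x 0 i2 + z * c).
  apply: (mulfI (expf_neq0 n.+1 f1_neq0)); rewrite mulr0 -e yE geval1.
  rewrite /Delta /cf1 /cf2 /cf3; ring.
move=> s [t [e0 e1 e2]].
exists (row_mx (row3 t s (- z)) w); rewrite mul_relsSS !row3E -wE.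
congr row_mx; last by rewrite mulNr scaleNr opprK subrK.
rewrite mul_curve_rels_Delta !row3E; apply: row3_eq; rewrite row3E.
- by apply: (addIr (z * (q * b))); rewrite e0; ring.
- by apply: (addIr (- (z * (a * q)))); rewrite e1; ring.
- by apply: (addIr (z * c)); rewrite e2; ring.
Qed.

(** Nonzero minors: pairing the bordered block with (f1, f2, f3) gives [u 0 i2 * D = 0], and a 2 x 2
    minor equal to [f1] up to sign kills the other two coordinates. *)
Lemma rels_inj n (w : 'rV[R]_(nrels n)) : w *m rels n = 0 -> w = 0.
Proof.
have key (x y : R) : - (x * b) - y * c = 0 -> x * a + y * b = 0 -> x = 0 /\ y = 0.
  move=> e1 e2; split; apply: (mulfI f1_neq0); rewrite mulr0.
    have -> : f1 * x = - b * (- (x * b) - y * c) - c * (x * a + y * b).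
      by rewrite /cf1; ring.
    by rewrite e1 e2 !mulr0 subr0.
  have -> : f1 * y = a * (- (x * b) - y * c) + b * (x * a + y * b).
    by rewrite /cf1; ring.
  by rewrite e1 e2 !mulr0 addr0.
elim/nat_ind2: n w => [w _|w|n IH w].
- by apply/rowP=> -[].
- rewrite mul_curve_rels => /rowP e; have := e i1; have := e i2.
  rewrite !row3E !mxE => e2 e1; have [w0 w1] := key _ _ e1 e2.
  by apply/rowP; case=> [[|[|//]] lt]; rewrite mxE; [rewrite -[RHS]w0|rewrite -[RHS]w1];
    congr (w _ _); apply: val_inj.
rewrite -[w]hsubmxK; move: (lsubmx w) (rsubmx w) => {w} u v.
rewrite mul_relsSS -[RHS]row_mx0 => /eq_row_mx[].
rewrite mul_curve_rels_Delta => /rowP e.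
have := e i0; have := e i1; have := e i2; rewrite !row3E !mxE => e2 e1 e0.
have u2 : u 0 i2 = 0.
  apply: (mulIf (Delta_neq0 f1_prime f1_ndvd_f2)); rewrite mul0r.
  have -> : u 0 i2 * D = (u 0 i0 * c + u 0 i1 * (a * q) + u 0 i2 * (q * b)) * f1
      + (- (u 0 i0 * b) - u 0 i1 * c - u 0 i2 * (a * q)) * f2
      + (u 0 i0 * a + u 0 i1 * b + u 0 i2 * c) * f3.
    by rewrite /Delta /cf1 /cf2 /cf3; ring.
  by rewrite e0 e1 e2 !mul0r !addr0.
move: e1 e2; rewrite u2 !mul0r subr0 addr0 => e1 e2; have [u0 u1] := key _ _ e1 e2.
rewrite scale0r subr0 => /IH ->; rewrite (_ : u = 0) ?row_mx0 //.
by apply: row3_eq; rewrite mxE.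
Qed.

End Generators.

(** * Weighted homogeneous parts of polynomials *)

Section HomogeneousParts.
Variables (k : fieldType) (r : nat) (d : 'I_r -> nat).
Local Notation T := {mpoly k[r]}.

Definition hpart (e : int) (f : T) : T :=
  \sum_(u <- msupp f | (wdeg d u)%:Z == e) f@_u *: 'X_[u].

Lemma wdegD u v : wdeg d (u + v)%MM = (wdeg d u + wdeg d v)%N.
Proof. by rewrite -big_split; apply: eq_bigr => i _; rewrite mnmDE mulnDl. Qed.

Lemma wdegU i : wdeg d U_(i)%MM = d i.
Proof.
rewrite /wdeg (bigD1 i) //= mnm1E eqxx mul1n big1 ?addn0 // => j ji.
by rewrite mnm1E eq_sym (negbTE ji).
Qed.

Lemma mcoeff_hpart e f u : (hpart e f)@_u = if (wdeg d u)%:Z == e then f@_u else 0.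
Proof.
rewrite /hpart raddf_sum /= big_mkcond.
have [uf|uf] := boolP (u \in msupp f); last first.
  rewrite big_seq big1 => [|v vf]; first by rewrite (memN_msupp_eq0 uf) if_same.
  case: ifP => // _; rewrite mcoeffZ mcoeffX; case: eqP => [vu|]; last by rewrite mulr0.
  by rewrite -vu vf in uf.
rewrite (bigD1_seq u) ?msupp_uniq //= big1 => [|v vu].
  by rewrite addr0 mcoeffZ mcoeffX eqxx mulr1.
by case: ifP => // _; rewrite mcoeffZ mcoeffX (negbTE vu) mulr0.
Qed.

Lemma hpartD e f g : hpart e (f + g) = hpart e f + hpart e g.
Proof.
by apply/mpolyP=> u; rewrite mcoeffD !mcoeff_hpart mcoeffD; case: ifP; rewrite ?addr0.
Qed.

Lemma hpartN e f : hpart e (- f) = - hpart e f.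
Proof.
by apply/mpolyP=> u; rewrite mcoeffN !mcoeff_hpart mcoeffN; case: ifP; rewrite ?oppr0.
Qed.

Lemma hpart0 e : hpart e 0 = 0.
Proof. by apply/mpolyP=> u; rewrite mcoeff_hpart mcoeff0 if_same. Qed.

Lemma hpart_sum e (I : Type) (s : seq I) (F : I -> T) :
  hpart e (\sum_(i <- s) F i) = \sum_(i <- s) hpart e (F i).
Proof. exact: (big_morph _ (hpartD e) (hpart0 e)). Qed.

Lemma whomogP e (f : T) : whomog d e f <-> forall u, f@_u != 0 -> (wdeg d u)%:Z = e.
Proof. by split=> H u; [rewrite -mcoeff_msupp | rewrite mcoeff_msupp]; apply: H. Qed.

Lemma whomog_hpart e (f : T) : whomog d e (hpart e f).
Proof. by apply/whomogP=> u; rewrite mcoeff_hpart; case: ifP; [move/eqP | rewrite eqxx]. Qed.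

Lemma hpart_id e (f : T) : whomog d e f -> hpart e f = f.
Proof.
move=> /whomogP H; apply/mpolyP=> u; rewrite mcoeff_hpart; case: eqP => // ne.
by have [//|/H] := eqVneq f@_u 0.
Qed.

Lemma whomogD e (f g : T) : whomog d e f -> whomog d e g -> whomog d e (f + g).
Proof.
by move=> hf hg; rewrite -(hpart_id hf) -(hpart_id hg) -hpartD; apply: whomog_hpart.
Qed.

Lemma whomogN e (f : T) : whomog d e f -> whomog d e (- f).
Proof. by move=> hf; rewrite -(hpart_id hf) -hpartN; apply: whomog_hpart. Qed.

Lemma whomogB e (f g : T) : whomog d e f -> whomog d e g -> whomog d e (f - g).
Proof. by move=> hf /whomogN; apply: whomogD. Qed.

Lemma whomog0 e : whomog d e (0 : T).
Proof. by rewrite -(hpart0 e); apply: whomog_hpart. Qed.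

Lemma whomog_sum e (I : Type) (s : seq I) (P : pred I) (F : I -> T) :
  (forall i, P i -> whomog d e (F i)) -> whomog d e (\sum_(i <- s | P i) F i).
Proof. by apply: big_ind; [exact: whomog0 | exact: whomogD]. Qed.

Lemma whomogC c : whomog d 0 (c%:MP : T).
Proof.
apply/whomogP=> u; rewrite mcoeffC; have [-> _|_] := eqVneq u 0%MM; last by rewrite mulr0 eqxx.
by rewrite /wdeg big1 // => i _; rewrite mnm0E.
Qed.

Lemma whomogX i : whomog d (d i)%:Z ('X_i : T).
Proof. by move=> u; rewrite msuppX inE => /eqP ->; rewrite wdegU. Qed.

Lemma hpartM e e' (f g : T) : whomog d e' g -> hpart e (f * g) = hpart (e - e') f * g.
Proof.
move=> /whomogP hg; apply/mpolyP=> u; rewrite mcoeff_hpart !mcoeffM.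
case: eqP => [ue|ue].
  apply: eq_bigr => -[v w] /= /eqP /(congr1 (wdeg d)); rewrite wdegD => uvw.
  rewrite mcoeff_hpart; case: eqP => // ne.
  have [->|/hg we] := eqVneq g@_w 0; first by rewrite !mulr0.
  by case: ne; lia.
rewrite big1 // => -[v w] /= /eqP /(congr1 (wdeg d)); rewrite wdegD mcoeff_hpart => uvw.
have [->|/hg we] := eqVneq g@_w 0; first by rewrite !mulr0.
case: eqP => [ve|_]; last by rewrite mul0r.
by case: ue; lia.
Qed.

Lemma whomogM e e' (f g : T) : whomog d e f -> whomog d e' g -> whomog d (e + e') (f * g).
Proof.
move=> hf hg; rewrite -(hpart_id hf) -[X in hpart X](addrK e') -(hpartM _ _ hg).
exact: whomog_hpart.
Qed.

Lemma whomog1 : whomog d 0 (1 : T). Proof. exact: whomogC. Qed.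

Lemma whomogXn n e (f : T) : whomog d e f -> whomog d (e *+ n) (f ^+ n).
Proof.
move=> hf; elim: n => [|n IH]; first by rewrite expr0; apply: whomog1.
by rewrite exprS mulrS; apply: whomogM.
Qed.

Lemma vars_idealP (f : T) : vars_ideal k r f <-> f@_0 = 0.
Proof.
split=> [|f0].
  suff: vars_ideal k r `<=` [set f | f@_0%MM = 0] by apply.
  apply: ideal_gen_min.
    split=> [|g h|g h] /=; first by rewrite mcoeff0.
      by rewrite mcoeffD => -> ->; rewrite addr0.
    by move=> h0; rewrite (rmorphM (mcoeff 0)) /= h0 mulr0.
  move=> _ [i _ <-] /=; rewrite mcoeffX; case: eqP => // /(congr1 (fun u : 'X_{1..r} => u i)).
  by rewrite mnm1E eqxx mnm0E.
rewrite [f]mpolyE big_seq; apply: ideal_sum; first exact: is_ideal_gen.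
move=> u uf; have [i ui] : exists i, u i != 0%N.
  apply/existsP; rewrite -negb_forall; apply: contraL uf => /forallP u0.
  rewrite -mcoeff_eq0 (_ : u = 0%MM) ?f0 //.
  by apply/mnmP=> i; rewrite mnm0E; apply/eqP.
have uE : u = (u - U_(i) + U_(i))%MM.
  apply/mnmP=> j; rewrite mnmDE mnmBE mnm1E subnK //.
  by case: eqP => // <-; rewrite lt0n.
rewrite uE mpolyXD scalerAl; have [_ _ iM] := is_ideal_gen (range (fun i : 'I_r => 'X_i : T)).
by apply: iM; apply: ideal_gen_sub; exists i.
Qed.

End HomogeneousParts.

(** * Comparison of minimal graded free resolutions *)

Section Uniqueness.
Variables (k : fieldType) (r : nat) (d : 'I_r -> nat).
Local Notation T := {mpoly k[r]}.

Definition homog_ideal (J : set T) := forall e f, J f -> J (hpart d e f).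

Section Graded.
Variables (m n : nat) (tm : 'I_m -> int) (tn : 'I_n -> int).

Definition gradedmx (M : 'M[T]_(m, n)) := forall i j, whomog d (tm i - tn j) (M i j).

(** Lifts provided by exactness need not be graded. By [gpartM], right multiplication by a graded
    matrix commutes with [gpart], so the graded part of a lift of a graded matrix is again a
    lift. *)
Definition gpart (M : 'M[T]_(m, n)) : 'M[T]_(m, n) :=
  \matrix_(i, j) hpart d (tm i - tn j) (M i j).

Lemma gradedmx_gpart M : gradedmx (gpart M).
Proof. by move=> i j; rewrite mxE; apply: whomog_hpart. Qed.

End Graded.

Lemma gradedmxM m n p (tm : 'I_m -> int) (tn : 'I_n -> int) (tp : 'I_p -> int) M N :
  gradedmx tm tn M -> gradedmx tn tp N -> gradedmx tm tp (M *m N).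
Proof.
move=> hM hN i j; rewrite mxE; apply: whomog_sum => l _.
by rewrite -(subrKA (tn l)); apply: whomogM.
Qed.

Lemma gpart_id m n (tm : 'I_m -> int) (tn : 'I_n -> int) M :
  gradedmx tm tn M -> gpart tm tn M = M.
Proof. by move=> hM; apply/matrixP=> i j; rewrite mxE hpart_id. Qed.

Lemma gpartM m n p (tm : 'I_m -> int) (tn : 'I_n -> int) (tp : 'I_p -> int) M N :
  gradedmx tn tp N -> gpart tm tp (M *m N) = gpart tm tn M *m N.
Proof.
move=> hN; apply/matrixP=> i j; rewrite !mxE hpart_sum; apply: eq_bigr => l _.
by rewrite mxE (hpartM _ _ (hN l j)); congr (hpart d _ _ * _); rewrite opprB addrA subrK.
Qed.

Lemma mul_mx_vars m n p (M : 'M[T]_(m, n)) (N : 'M[T]_(n, p)) :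
  (forall i j, vars_ideal k r (N i j)) -> forall i j, vars_ideal k r ((M *m N) i j).
Proof.
move=> hN i j; rewrite mxE; apply: ideal_sum => [|l _]; first exact: is_ideal_gen.
have [_ _ iM] := is_ideal_gen (range (fun i : 'I_r => 'X_i : T)).
by apply: iM; apply: hN.
Qed.

Lemma mul_vars_mx m n p (M : 'M[T]_(m, n)) (N : 'M[T]_(n, p)) :
  (forall i j, vars_ideal k r (M i j)) -> forall i j, vars_ideal k r ((M *m N) i j).
Proof.
move=> hM i j; rewrite mxE; apply: ideal_sum => [|l _]; first exact: is_ideal_gen.
have [_ _ iM] := is_ideal_gen (range (fun i : 'I_r => 'X_i : T)).
by rewrite mulrC; apply: iM; apply: hM.
Qed.

Lemma mx_rows_choice m n p (M : 'M[T]_(m, p)) (N : 'M[T]_(n, p)) :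
  (forall i, exists w : 'rV_n, row i M = w *m N) -> exists W, M = W *m N.
Proof.
move=> /choice[w wP]; exists (\matrix_i w i).
by apply/row_matrixP=> i; rewrite row_mul rowK.
Qed.

Variables (I J : set T).
Hypothesis J_ideal : is_ideal J.
Hypothesis J_homog : homog_ideal J.

Section Comparison.
Variables F G : free_complex k r.
Hypothesis F_res : minimal_graded_free_resolution d F I J.
Hypothesis G_res : minimal_graded_free_resolution d G I J.

Local Notation twF i := (@fc_twist k r F i).
Local Notation twG i := (@fc_twist k r G i).

Lemma resolves_exact (H : free_complex k r) i m (M : 'M_(m, _)) :
  minimal_graded_free_resolution d H I J ->
  M *m fc_diff H i = 0 -> exists W, M = W *m fc_diff H i.+1.
Proof.
case=> _ [_ _ _ ex] _ M0; apply: mx_rows_choice => a.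
by apply/ex; rewrite -row_mul M0 row0.
Qed.

Lemma resolves_complex (H : free_complex k r) i :
  minimal_graded_free_resolution d H I J -> fc_diff H i.+1 *m fc_diff H i = 0.
Proof.
case=> _ [_ _ _ ex] _; apply/row_matrixP=> a; rewrite row_mul row0.
by apply/ex; exists (delta_mx 0 a); rewrite -rowE.
Qed.

(* A graded comparison F_i -> G_i -> F_i in degree i: it extends to degree
   i + 1, and it is the identity up to a homotopy whose component in degree i
   is h. *)
Definition comparison i (A : 'M[T]_(fc_rank F i, fc_rank G i))
    (B : 'M[T]_(fc_rank G i, fc_rank F i)) (h : 'M[T]_(fc_rank F i, fc_rank F i.+1)) :=
  [/\ gradedmx (twF i) (twG i) A,
      exists W, fc_diff F i *m A = W *m fc_diff G i,
      exists W, fc_diff G i *m B = W *m fc_diff F i,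
      fc_diff F i *m (1%:M - A *m B - h *m fc_diff F i) = 0
    & forall a b, vars_ideal k r ((1%:M - A *m B) a b)].

(** Exactness turns [1 - A' B' - d_i h] into [h' d_(i+1)], and minimality puts both homotopy terms
    in the maximal ideal. Only [A'] is made graded, since the twists are read off it. *)
Lemma comparison_step i A B h :
  @comparison i A B h -> exists A' B' h', @comparison i.+1 A' B' h'.
Proof.
case=> gA [W WE] [B' BE] hom _.
have [grF _ minF] := F_res; have [grG _ _] := G_res.
pose A' := gpart (twF i.+1) (twG i.+1) W.
have gdF : gradedmx (twF i.+1) (twF i) (fc_diff F i) by move=> a b; apply: grF.2.
have gdG : gradedmx (twG i.+1) (twG i) (fc_diff G i) by move=> a b; apply: grG.2.
have AE : fc_diff F i *m A = A' *m fc_diff G i.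
  by rewrite -(gpartM _ _ gdG) -WE gpart_id //; apply: gradedmxM gA.
have [|h' hE] := @resolves_exact F i _ (1%:M - A' *m B' - fc_diff F i *m h) F_res.
  rewrite -[RHS]hom !mulmxBl !mulmxBr mul1mx mulmx1 -!mulmxA -BE.
  by rewrite [A' *m (_ *m _)]mulmxA -AE -mulmxA.
exists A', B', h'; split.
- exact: gradedmx_gpart.
- by apply: resolves_exact => //; rewrite -mulmxA -AE mulmxA resolves_complex // mul0mx.
- by apply: resolves_exact => //; rewrite -mulmxA -BE mulmxA resolves_complex // mul0mx.
- by rewrite -hE opprB addrC subrK mulmxA resolves_complex // mul0mx.
move=> a b; rewrite -[1%:M - _](subrK (fc_diff F i *m h)) hE mxE.
have [_ iD _] := is_ideal_gen (range (fun i : 'I_r => 'X_i : T)).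
apply: iD; first by apply: mul_mx_vars; apply: minF.
by apply: mul_vars_mx; apply: minF.
Qed.

End Comparison.

Definition aug_col (F : free_complex k r) : 'cV[T]_(fc_rank F 0) := \col_j fc_aug j.

Lemma fc_epsE (F : free_complex k r) v : fc_eps v = (v *m aug_col F) 0 0.
Proof. by rewrite mxE; apply: eq_bigr => j _; rewrite mxE. Qed.

Lemma fc_eps_row (F : free_complex k r) m (M : 'M[T]_(m, fc_rank F 0)) a :
  fc_eps (row a M) = (M *m aug_col F) a 0.
Proof. by rewrite fc_epsE -row_mul mxE. Qed.

Lemma resolves_exact0 (F : free_complex k r) m (M : 'M[T]_(m, fc_rank F 0)) :
  fc_resolves F I J ->
  (forall a, J ((M *m aug_col F) a 0)) -> exists W, M = W *m fc_diff F 0.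
Proof.
by case=> _ _ ex _ MJ; apply: mx_rows_choice => a; apply/ex; rewrite fc_eps_row.
Qed.

Lemma resolves_complex0 (F : free_complex k r) a :
  fc_resolves F I J -> J ((fc_diff F 0 *m aug_col F) a 0).
Proof.
case=> _ _ ex _; rewrite -fc_eps_row; apply/ex.
by exists (delta_mx 0 a); rewrite -rowE.
Qed.

Lemma ideal_mulmx m n (M : 'M[T]_(m, n)) (N : 'cV[T]_n) a :
  (forall b, J (N b 0)) -> J ((M *m N) a 0).
Proof.
have [_ _ JM] := J_ideal.
by move=> NJ; rewrite mxE; apply: ideal_sum => // b _; apply: JM.
Qed.

Lemma comparison_aug F G :
  minimal_graded_free_resolution d F I J -> minimal_graded_free_resolution d G I J ->
  exists2 A, gradedmx (@fc_twist k r F 0) (@fc_twist k r G 0) A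
    & forall a, J ((aug_col F - A *m aug_col G) a 0).
Proof.
case=> -[grF _] [augF _ _ _] _ [[grG _] [_ onG _ _] _].
have /choice[w wP] : forall a : 'I_(fc_rank F 0), exists v, J (fc_aug a - @fc_eps k r G v).
  by move=> a; apply: onG; apply: augF.
pose W : 'M[T]_(fc_rank F 0, fc_rank G 0) := \matrix_a w a.
have gG : gradedmx (@fc_twist k r G 0) (fun=> 0) (aug_col G).
  by move=> i j; rewrite mxE subr0; apply: grG.
have gF : gradedmx (@fc_twist k r F 0) (fun=> 0) (aug_col F).
  by move=> i j; rewrite mxE subr0; apply: grF.
exists (gpart (@fc_twist k r F 0) (@fc_twist k r G 0) W).
  exact: gradedmx_gpart.
move=> a; rewrite -(gpartM _ W gG) -(gpart_id gF) !mxE -hpartN -hpartD.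
by apply: J_homog; move: (wP a); rewrite -[w a](rowK w) fc_eps_row !mxE.
Qed.

Lemma comparison_ex F G i :
  minimal_graded_free_resolution d F I J -> minimal_graded_free_resolution d G I J ->
  exists A B h, @comparison F G i A B h.
Proof.
move=> F_res G_res; elim: i => [|i [A [B [h H]]]]; last exact: comparison_step H.
have [_ rF minF] := F_res; have [_ rG _] := G_res.
have [A gA AE] := comparison_aug F_res G_res.
have [B _ BE] := comparison_aug G_res F_res.
have [h hE] : exists h, 1%:M - A *m B = h *m fc_diff F 0.
  apply: resolves_exact0 => // a.
  have -> : (1%:M - A *m B) *m aug_col F = (aug_col F - A *m aug_col G)
      + A *m (aug_col G - B *m aug_col F).
    by rewrite mulmxBl mul1mx mulmxBr mulmxA addrA subrK.
  by have [_ JD _] := J_ideal; rewrite mxE; apply: JD; [apply: AE | apply: ideal_mulmx].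
have lift (X Y : free_complex k r) C : fc_resolves X I J -> fc_resolves Y I J ->
    (forall a, J ((aug_col X - C *m aug_col Y) a 0)) ->
    exists W, fc_diff X 0 *m C = W *m fc_diff Y 0.
  move=> rX rY CE; apply: resolves_exact0 => // a.
  have -> : fc_diff X 0 *m C *m aug_col Y = fc_diff X 0 *m aug_col X
      - fc_diff X 0 *m (aug_col X - C *m aug_col Y).
    by rewrite mulmxBr opprB addrC subrK mulmxA.
  rewrite mxE [X in _ + X]mxE; apply: ideal_sub => //; first exact: resolves_complex0.
  exact: ideal_mulmx.
exists A, B, h; split=> //.
- exact: lift.
- exact: lift.
- by rewrite hE subrr mulmx0.
- by rewrite hE; apply: mul_mx_vars; apply: minF.
Qed.

(** A diagonal entry of [A *m B] has constant term 1, so some [A a b] has a nonzero constant term;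
    being homogeneous of degree [fc_twist a - fc_twist b], it forces this difference to be 0. A
    maximum depends only on the set of twists, so multiplicities are not compared. *)
Lemma twist_unique F G i (a : 'I_(fc_rank F i)) :
  minimal_graded_free_resolution d F I J -> minimal_graded_free_resolution d G I J ->
  exists b : 'I_(fc_rank G i), fc_twist a = fc_twist b.
Proof.
move=> F_res G_res; have [A [B [h [gA _ _ _]]]] := comparison_ex i F_res G_res.
move=> /(_ a a) /vars_idealP; rewrite !mxE eqxx /= mcoeffB mcoeff1 eqxx raddf_sum /=.
have [b Ab|A0] := pickP (fun b => (A a b)@_0%MM != 0).
  move=> _; exists b; have /whomogP/(_ _ Ab) := gA a b.
  rewrite /wdeg big1 => [/esym/eqP|i0 _]; last by rewrite mnm0E.
  by rewrite subr_eq0 => /eqP.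
rewrite big1 ?subr0 => [/eqP|b _]; first by rewrite oner_eq0.
by rewrite (rmorphM (mcoeff 0)) /=; move/negbFE/eqP: (A0 b) => ->; rewrite mul0r.
Qed.

Lemma regularity_eq F e : minimal_graded_free_resolution d F I J ->
  (exists i (j : 'I_(fc_rank F i)), fc_twist j - i%:Z = e) ->
  (forall i (j : 'I_(fc_rank F i)), fc_twist j - i%:Z <= e) ->
  regularity d I J = e.
Proof.
move=> F_res [i [a ae]] ub; apply: xget_unique; first by exists F; split=> //; exists i, a.
move=> _ [G [G_res [j [b <-]] ub']].
apply/le_anti/andP; split.
  by have [a' ->] := twist_unique b G_res F_res; apply: ub.
by rewrite -ae; have [b' ->] := twist_unique a F_res G_res; apply: ub'.
Qed.

End Uniqueness.

(** * Substitutions and regular sequences in three variables *)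

Section ThreeVariables.
Variable k : fieldType.
Local Notation T := {mpoly k[3]}.

Definition xa : T := 'X_i0.
Definition xb : T := 'X_i1.
Definition xc : T := 'X_i2.

Lemma big_ord3 (R : Type) (idx : R) (op : Monoid.law idx) (F : 'I_3 -> R) :
  \big[op/idx]_(i < 3) F i = op (F i0) (op (F i1) (F i2)).
Proof. by rewrite !big_ord_recl big_ord0 Monoid.mulm1. Qed.

Lemma mpolyX3 (u : 'X_{1..3}) : 'X_[u] = xa ^+ u i0 * xb ^+ u i1 * xc ^+ u i2.
Proof. by rewrite mpolyXE_id big_ord3 /= mulrA. Qed.

Lemma mpoly_gen_ind r (P : {mpoly k[r]} -> Prop) :
  (forall c, P c%:MP) -> (forall i, P 'X_i) ->
  (forall f g, P f -> P g -> P (f + g)) -> (forall f g, P f -> P g -> P (f * g)) ->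
  forall f, P f.
Proof.
move=> PC PX PD PM f; rewrite [f]mpolyE; apply: big_ind => [||u _].
- by rewrite -mpolyC0.
- exact: PD.
rewrite -mul_mpolyC; apply: (PM) => //; rewrite mpolyXE_id.
apply: big_ind => [||i _]; [by rewrite -mpolyC1 | exact: PM |].
elim: (u i) => [|n IH]; first by rewrite expr0 -mpolyC1.
by rewrite exprS; apply: PM.
Qed.

(** Realizes the quotient by some of the variables as a subring of [T], so that cancellation modulo
    these variables takes place in the domain [T]. *)
Definition kill_vars (P : pred 'I_3) : T -> T :=
  mmap (@mpolyC 3 k) (fun i => if P i then 0 else 'X_i).

Lemma kill_varsP (P : pred 'I_3) (I : set T) f :
  is_ideal I -> (forall i, P i -> I 'X_i) -> I (f - kill_vars P f).
Proof.
move=> iI IX; have [I0 ID IM] := iI; elim/mpoly_gen_ind: f => [c|i|f g If Ig|f g If Ig].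
- by rewrite /kill_vars mmapC subrr.
- rewrite /kill_vars mmapX mmap1U; case: ifP => Pi; last by rewrite subrr.
  by rewrite subr0; apply: IX.
- by rewrite /kill_vars mmapD opprD addrACA; apply: ID.
- rewrite /kill_vars rmorphM /=.
  rewrite (_ : _ - _ = f * (g - kill_vars P g) + kill_vars P g * (f - kill_vars P f)).
    by apply: ID; apply: IM.
  by rewrite /kill_vars; ring.
Qed.

Lemma kill_varsM P f g : kill_vars P (f * g) = kill_vars P f * kill_vars P g.
Proof. exact: rmorphM. Qed.

Lemma kill_varsX P i : kill_vars P 'X_i = if P i then 0 else 'X_i.
Proof. by rewrite /kill_vars mmapX mmap1U. Qed.

Lemma mpolyX_neq0 r (i : 'I_r) : ('X_i : {mpoly k[r]}) != 0.
Proof. by rewrite -msupp_eq0 msuppX. Qed.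

Lemma xab_regular (x y : T) : xa * x + xb * y = 0 ->
  exists s, x = xb * s /\ y = - (xa * s).
Proof.
move=> e; have [s sE] : [set f : T | exists s, f = xb * s] (x - kill_vars (pred1 i1) x).
  apply: kill_varsP => [|i /eqP ->]; last by exists 1; rewrite mulr1.
  split=> [|f g [s ->] [t ->]|f g [s ->]]; first by exists 0; rewrite mulr0.
    by exists (s + t); rewrite mulrDr.
  by exists (f * s); rewrite mulrCA.
have x0 : kill_vars (pred1 i1) x = 0.
  have ka : kill_vars (pred1 i1) xa = xa by rewrite kill_varsX.
  apply: (mulfI (mpolyX_neq0 i0)); rewrite mulr0 -[X in X * _]ka -kill_varsM.
  move/(congr1 (kill_vars (pred1 i1))): e.
  by rewrite /kill_vars rmorphD /= rmorph0 [X in _ + X]rmorphM /= mmapX mmap1U /= mul0r addr0.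
exists s; rewrite x0 subr0 in sE; split=> //.
apply: (mulfI (mpolyX_neq0 i1)); apply: subr0_eq; rewrite -e sE /xa /xb; ring.
Qed.

Lemma xabc_regular (w x y : T) : w * xc ^+ 2 = xa * x + xb * y ->
  exists x' y', w = xa * x' + xb * y'.
Proof.
move=> e; pose P := pred2 i0 i1.
have [s [t sE]] : [set f : T | exists s t, f = xa * s + xb * t] (w - kill_vars P w).
  apply: kill_varsP => [|i /orP[]/eqP ->]; last 2 first.
  - by exists 1, 0; rewrite mulr1 mulr0 addr0.
  - by exists 0, 1; rewrite mulr1 mulr0 add0r.
  split=> [|f g [s [s' ->]] [t [t' ->]]|f g [s [s' ->]]]; first by exists 0, 0; rewrite !mulr0 addr0.
    by exists (s + t), (s' + t'); rewrite !mulrDr addrACA.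
  by exists (f * s), (f * s'); rewrite mulrDr; congr (_ + _); rewrite mulrCA.
have w0 : kill_vars P w = 0.
  apply: (mulIf (expf_neq0 2 (mpolyX_neq0 i2))); rewrite mul0r.
  move/(congr1 (kill_vars P)): e; rewrite kill_varsM /kill_vars rmorphXn /= mmapX mmap1U /= => ->.
  by rewrite rmorphD /= !rmorphM /= !mmapX !mmap1U /= !mul0r addr0.
by exists s, t; rewrite -sE w0 subr0.
Qed.

Lemma vars_ideal3P (g : T) :
  vars_ideal k 3 g <-> exists x y z, g = x * xa + y * xb + z * xc.
Proof.
have [_ iD iM] := is_ideal_gen (range (fun i : 'I_3 => 'X_i : T)).
have Xv i : vars_ideal k 3 'X_i by apply: ideal_gen_sub; exists i.
split=> [|[x [y [z ->]]]]; last by do 2 ?[apply: (iD)]; apply: (iM); apply: (Xv).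
suff: vars_ideal k 3 `<=` [set g | exists x y z, g = x * xa + y * xb + z * xc] by apply.
apply: ideal_gen_min.
  split=> [|f h [x [y [z ->]]] [x' [y' [z' ->]]]|f h [x [y [z ->]]]].
  - by exists 0, 0, 0; rewrite !mul0r !addr0.
  - by exists (x + x'), (y + y'), (z + z'); ring.
  - by exists (f * x), (f * y), (f * z); ring.
move=> _ [i _ <-]; have [->|[->|->]] : i = i0 \/ i = i1 \/ i = i2.
- by case: i => [[|[|[|//]]] lt]; [left | right; left | right; right]; apply: val_inj.
- by exists 1, 0, 0; rewrite /xa; ring.
- by exists 0, 1, 0; rewrite /xb; ring.
- by exists 0, 0, 1; rewrite /xc; ring.
Qed.

(* If nu is a normal form for monomials modulo J separating exactly the fibres
   of the grading delta, then J contains every polynomial all of whose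
   coefficient sums over fibres of delta vanish. *)
Lemma fiber_sums_mem (J : set T) (S : eqType) (delta : 'X_{1..3} -> S)
    (nu : 'X_{1..3} -> 'X_{1..3}) (f : T) :
  is_ideal J -> (forall u, J ('X_[u] - 'X_[nu u])) ->
  (forall u v, delta u = delta v <-> nu u = nu v) ->
  (forall s, \sum_(u <- msupp f | delta u == s) f@_u = 0) -> J f.
Proof.
move=> iJ Jnu nuE f0; have [_ _ JM] := iJ.
have -> : f = \sum_(u <- msupp f) (f@_u)%:MP_[3] * ('X_[u] - 'X_[nu u]).
  transitivity (f - \sum_(u <- msupp f) f@_u *: 'X_[nu u]); last first.
    rewrite {1}[f]mpolyE -sumrB; apply: eq_bigr => u _.
    by rewrite -scalerBr mul_mpolyC.
  rewrite (_ : \sum_(u <- _) _ = 0) ?subr0 //; apply/mpolyP=> w.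
  rewrite raddf_sum /= mcoeff0.
  have [/hasP[v vf /eqP vw]|/hasPn nw] := boolP (has (fun v => nu v == w) (msupp f)).
    rewrite -[RHS](f0 (delta v)) [RHS]big_mkcond /=; apply: eq_bigr => u _.
    rewrite mcoeffZ mcoeffX -vw (_ : (nu u == nu v) = (delta u == delta v)).
      by case: ifP; rewrite ?mulr1 ?mulr0.
    by apply/eqP/eqP => /nuE.
  rewrite big_seq big1 // => u /nw /negbTE nuw.
  by rewrite mcoeffZ mcoeffX nuw mulr0.
by apply: ideal_sum => // u _; apply: JM.
Qed.

Definition mon3 (x y z : nat) : 'X_{1..3} := [multinom nth 0%N [:: x; y; z] i | i < 3].

Lemma mon3E x y z : (mon3 x y z i0 = x) * (mon3 x y z i1 = y) * (mon3 x y z i2 = z).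
Proof. by rewrite !mnmE. Qed.

Lemma mon3K (u : 'X_{1..3}) : mon3 (u i0) (u i1) (u i2) = u.
Proof.
apply/mnmP; case=> [[|[|[|//]]] lt]; rewrite mnmE /=; congr (u _); exact: val_inj.
Qed.

End ThreeVariables.

(** * The conic, the curve, and normal forms of monomials *)

Section Curve.
Variables (k : fieldType) (m : nat).
Local Notation T := {mpoly k[3]}.
Local Notation a := (xa k).
Local Notation b := (xb k).
Local Notation c := (xc k).
Local Notation q := (a ^+ m).
Local Notation f1 := (cf1 a b c).
Local Notation f2 := (cf2 a b c q).
Local Notation f3 := (cf3 a b c q).
Local Notation J := (curveJ a b c q).

Definition mon2 (p : nat * nat) : 'X_{1..2} := [multinom nth 0%N [:: p.1; p.2] i | i < 2].

Lemma mon2_inj : injective mon2.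
Proof.
move=> [x y] [x' y'] /mnmP e; have := e ord0; have := e (lift ord0 ord0).
by rewrite !mnmE /= => -> ->.
Qed.

(** Exponents under the parametrization a = s^2, b = s t, c = t^2 of the conic b^2 = a c. *)
Definition conic_deg (u : 'X_{1..3}) : nat * nat :=
  (2 * u i0 + u i1, u i1 + 2 * u i2)%N.

(* The kernel of this domain-valued map is generated by b ^ 2 - a c. *)
Definition conic : T -> {mpoly k[2]} :=
  mmap (@mpolyC 2 k) (fun i => 'X_[mon2 (conic_deg U_(i)%MM)]).

Lemma conic_mmap1 u :
  mmap1 (fun i => 'X_[mon2 (conic_deg U_(i)%MM)] : {mpoly k[2]}) u = 'X_[mon2 (conic_deg u)].
Proof.
rewrite /mmap1 big_ord3 /= !mpolyXn -!mpolyXD; congr 'X_[_].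
apply/mnmP; case=> [[|[|//]] lt]; rewrite !(mnmDE, mulmnE, mnmE) /= ?mnm1E /=; lia.
Qed.

Lemma mcoeff_conic f p :
  (conic f)@_(mon2 p) = \sum_(u <- msupp f | conic_deg u == p) f@_u.
Proof.
rewrite /conic /mmap raddf_sum /= [RHS]big_mkcond; apply: eq_bigr => u _.
rewrite conic_mmap1 mcoeffCM mcoeffX (inj_eq mon2_inj).
by case: ifP; rewrite ?mulr1 ?mulr0.
Qed.

Lemma conic_f1 : conic f1 = 0.
Proof.
rewrite /conic /cf1 rmorphB rmorphXn rmorphM /= !mmapX !mmap1U mpolyXn -mpolyXD.
apply/eqP; rewrite subr_eq0; apply/eqP; congr 'X_[_].
by apply/mnmP; case=> [[|[|//]] lt]; rewrite !(mnmDE, mulmnE, mnmE) /= ?mnm1E.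
Qed.

(** Here [nu] rewrites [b ^+ 2] to [a * c] until the exponent of [b] is at most one; the remaining
    monomials are told apart by [conic_deg]. *)
Lemma conic_eq0 f : conic f = 0 -> exists t, f = f1 * t.
Proof.
move=> f0; pose nu (u : 'X_{1..3}) := mon3 (u i0 + (u i1)./2) (odd (u i1)) (u i2 + (u i1)./2).
apply: (@fiber_sums_mem k [set f | exists t, f = f1 * t] _ conic_deg nu).
- split=> [|x y [s ->] [t ->]|x y [s ->]]; first by exists 0; rewrite mulr0.
    by exists (s + t); rewrite mulrDr.
  by exists (x * s); rewrite mulrCA.
- move=> u; rewrite !mpolyX3 !mon3E !exprD -[in X in X - _](odd_double_half (u i1)).
  rewrite exprD -mul2n exprM.
  have := subrXX (b ^+ 2) (a * c) (u i1)./2.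
  move: (\sum_(_ < _) _) => s; rewrite [(a * c) ^+ _]exprMn => sE.
  by exists (a ^+ u i0 * b ^+ odd (u i1) * c ^+ u i2 * s); rewrite [RHS]mulrCA /cf1 -sE; ring.
- move=> u v; rewrite /conic_deg /nu; split.
    by case=> e1 e2; congr mon3; lia.
  move=> /mnmP e; have := e i0; have := e i1; have := e i2; rewrite !mon3E => e2 e1 e0.
  by congr pair; lia.
- by move=> s; rewrite -mcoeff_conic f0 mcoeff0.
Qed.

Lemma f1_prime (x y z : T) : x * y = f1 * z ->
  (exists t, x = f1 * t) \/ (exists t, y = f1 * t).
Proof.
move=> /(congr1 conic).
have conicM : {morph conic : u v / u * v} by exact: rmorphM.
rewrite !conicM conic_f1 mul0r => /eqP.
by rewrite mulf_eq0 => /orP[]/eqP/conic_eq0; [left | right].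
Qed.

Lemma f1_neq0 : f1 != 0.
Proof.
apply/eqP=> /(congr1 (kill_vars (pred1 i0))).
rewrite /kill_vars /cf1 rmorphB rmorphXn rmorphM rmorph0 /= !mmapX !mmap1U /= mul0r subr0.
by apply/eqP; rewrite expf_neq0 // mpolyX_neq0.
Qed.

(** Setting [b] and [c] to 0 kills [f1] but leaves [- (a ^+ 2 * q)] of [f2]. *)
Lemma f1_ndvd_f2 (t : T) : f2 <> f1 * t.
Proof.
move=> /(congr1 (kill_vars (pred2 i1 i2))); rewrite kill_varsM.
rewrite /kill_vars /cf1 /cf2 !rmorphB !rmorphM !rmorphXn /= !mmapX !mmap1U /=.
rewrite ?expr0n /= !(mulr0, mul0r, sub0r, oppr0) => /eqP.
by apply/negP; rewrite oppr_eq0 !mulf_neq0 ?expf_neq0 ?mpolyX_neq0.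
Qed.

Definition wts : 'I_3 -> nat := tnth [tuple 3; 3 + m; 3 + 2 * m]%N.

Lemma wtsE : (wts i0 = 3)%N * (wts i1 = 3 + m)%N * (wts i2 = 3 + 2 * m)%N.
Proof. by []. Qed.

Lemma wdeg3 u : wdeg wts u = (u i0 * 3 + (u i1 * (3 + m) + u i2 * (3 + 2 * m)))%N.
Proof. by rewrite /wdeg big_ord3. Qed.

Definition param : T -> {poly k} := mmap (@polyC k) (fun i => 'X^(wts i)).

Lemma param_mmap1 u : mmap1 (fun i => 'X^(wts i) : {poly k}) u = 'X^(wdeg wts u).
Proof. by rewrite /mmap1 wdeg3 big_ord3 /= !wtsE -!exprM -!exprD; congr 'X^_; lia. Qed.

Lemma paramX u : param 'X_[u] = 'X^(wdeg wts u).
Proof. by rewrite /param mmapX param_mmap1. Qed.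

Lemma coef_param f n : (param f)`_n = \sum_(u <- msupp f | wdeg wts u == n) f@_u.
Proof.
rewrite /param /mmap coef_sum [RHS]big_mkcond; apply: eq_bigr => u _.
rewrite param_mmap1 coefCM coefXn eq_sym.
by case: ifP; rewrite ?mulr1 ?mulr0.
Qed.

Lemma param_f : (param f1 = 0) * (param f2 = 0) * (param f3 = 0).
Proof.
rewrite /param /cf1 /cf2 /cf3 !rmorphB !rmorphM !rmorphXn /= !mmapX !mmap1U !wtsE.
by split; [split|]; apply/eqP; rewrite subr_eq0 -?exprM -?exprD; apply/eqP; congr 'X^_; lia.
Qed.

Lemma param_curveJ f : J f -> param f = 0.
Proof.
case=> x [y [z ->]]; have [[e1 e2] e3] := param_f.
rewrite /param !rmorphD !rmorphM /=; move: e1 e2 e3; rewrite /param => -> -> ->.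
by rewrite !mulr0 !addr0.
Qed.

(** The monomials a^i, a^i b, a^i c, indexed by 3 i, 3 i + 1, 3 i + 2. The index is the degree for
    the weights 3, 1, 2, chosen so that reduction modulo [J] never lowers it; the ordinary degree of
    [nfmon j] is j / 3 rounded up. *)
Definition nfmon (j : nat) : 'X_{1..3} := mon3 (j %/ 3)%N (j %% 3 == 1)%N (j %% 3 == 2)%N.

(** The rewritings b^2 -> a c, c^2 -> a^(m+1) b and b c -> a^(m+2) lower the total exponent of [b]
    and [c], on which the induction runs, and lower neither the index nor the ordinary degree. *)
Lemma monomial_nf (u : 'X_{1..3}) : exists j : nat,
  [/\ (u i0 * 3 + u i1 + 2 * u i2 <= j)%N, (3 * mdeg u <= j + 2)%N
    & J ('X_[u] - 'X_[nfmon j])].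
Proof.
have dE (v : 'X_{1..3}) : mdeg v = (v i0 + (v i1 + v i2))%N by rewrite mdegE big_ord3.
have [_ JD JM] := is_ideal_curveJ a b c q.
have [N] : exists N, (u i1 + u i2 <= N)%N by exists (u i1 + u i2)%N.
elim: N u => [|N IH] u uN.
  exists (u i0 * 3)%N; rewrite dE; split; [lia | lia |].
  rewrite (_ : nfmon _ = u) ?subrr; first by have [] := is_ideal_curveJ a b c q.
  rewrite /nfmon modnMl mulnK //= -[RHS]mon3K; congr mon3; lia.
have step (v : 'X_{1..3}) (w : T) : 'X_[u] = 'X_[v] + w :> T -> J w -> (v i1 + v i2 <= N)%N ->
    (u i0 * 3 + u i1 + 2 * u i2 <= v i0 * 3 + v i1 + 2 * v i2)%N ->
    (mdeg u <= mdeg v)%N ->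
    exists j : nat, [/\ (u i0 * 3 + u i1 + 2 * u i2 <= j)%N, (3 * mdeg u <= j + 2)%N
    & J ('X_[u] - 'X_[nfmon j])].
  move=> uE Jw vN iuv duv; have [j [j1 j2 Jj]] := IH v vN.
  exists j; split; [lia | lia |].
  by rewrite uE addrAC; apply: JD.
have [u1|u1] := leqP 2 (u i1).
  apply: (step (mon3 (u i0).+1 (u i1 - 2) (u i2).+1)
     (a ^+ u i0 * b ^+ (u i1 - 2) * c ^+ u i2 * f1)); rewrite ?dE ?mon3E; try lia.
    rewrite !mpolyX3 !mon3E -{1}(subnK u1) exprD !exprS /cf1; ring.
  by apply: JM; apply: curveJ1.
have [u2|u2] := leqP 2 (u i2).
  apply: (step (mon3 (u i0 + m.+1) (u i1).+1 (u i2 - 2))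
     (a ^+ u i0 * b ^+ u i1 * c ^+ (u i2 - 2) * f3)); rewrite ?dE ?mon3E; try lia.
    rewrite !mpolyX3 !mon3E -{1}(subnK u2) !exprD !exprS /cf3; ring.
  by apply: JM; apply: curveJ3.
have [u0|u0] := leqP 2 (u i1 + u i2).
  have [u1' u2'] : u i1 = 1%N /\ u i2 = 1%N by lia.
  apply: (step (mon3 (u i0 + m.+2) 0 0) (a ^+ u i0 * f2)); rewrite ?dE ?mon3E; try lia.
    rewrite !mpolyX3 !mon3E u1' u2' !exprD !exprS /cf2; ring.
  by apply: JM; apply: curveJ2.
exists (u i0 * 3 + u i1 + 2 * u i2)%N; rewrite dE; split; [lia | lia |].
rewrite (_ : nfmon _ = u) ?subrr; first by have [] := is_ideal_curveJ a b c q.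
by rewrite /nfmon -[RHS]mon3K; congr mon3; lia.
Qed.

Hypothesis m_gt0 : (1 <= m)%N.
Hypothesis m_coprime : coprime 3 m.

Definition nfdeg (j : nat) : nat := wdeg wts (nfmon j).

(** Modulo 3 the weights are 0, m and 2 m, distinct because 3 does not divide m; hence the weight
    determines [j %% 3], and then [j]. *)
Lemma nfdeg_inj : injective nfdeg.
Proof.
move=> i j; rewrite /nfdeg !wdeg3 /nfmon !mon3E.
have m3 : (m %% 3)%N != 0%N by rewrite -/(3 %| m)%N -prime_coprime.
have i3 := ltn_pmod i (isT : (0 < 3)%N); have j3 := ltn_pmod j (isT : (0 < 3)%N).
move: (divn_eq i 3) (divn_eq j 3).
move: (i %/ 3)%N (i %% 3)%N i3 (j %/ 3)%N (j %% 3)%N j3 => x r r3 y s s3 ei ej.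
by case: r r3 ei => [|[|[|//]]] _ ei; case: s s3 ej => [|[|[|//]]] _ ej;
  rewrite /= ?mul1n ?mul0n; lia.
Qed.

Lemma wdeg_nf (u : 'X_{1..3}) : exists j : nat,
  [/\ (u i0 * 3 + u i1 + 2 * u i2 <= j)%N, (3 * mdeg u <= j + 2)%N,
      J ('X_[u] - 'X_[nfmon j]) & wdeg wts u = nfdeg j].
Proof.
have [j [j1 j2 Jj]] := monomial_nf u; exists j; split=> //.
have /eqP := param_curveJ Jj; rewrite /param rmorphB /= -!/(param _) !paramX subr_eq0.
by move=> /eqP/(congr1 (fun p : {poly k} => size p)); rewrite !size_polyXn => -[].
Qed.

(** Monomials of equal weight share their normal form, and the coefficients of [param f] are the
    fibre sums required by [fiber_sums_mem]. *)
Lemma curve_idealE : curve_ideal k wts = J.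
Proof.
apply/seteqP; split=> f; last exact: param_curveJ.
move=> f0; have /choice[j jP] := wdeg_nf.
apply: (@fiber_sums_mem k J _ (wdeg wts) (nfmon \o j)).
- exact: is_ideal_curveJ.
- by move=> u; have [] := jP u.
- move=> u v; have [_ _ _ eu] := jP u; have [_ _ _ ev] := jP v.
  by rewrite eu ev; split=> [/nfdeg_inj/= ->//|/= e]; rewrite /nfdeg e.
- by move=> n; rewrite -coef_param (f0 : param f = 0) coef0.
Qed.

Lemma curveJ_prime x y : J (x * y) -> J x \/ J y.
Proof.
rewrite -curve_idealE => xy0; have : param (x * y) = 0 by [].
rewrite /param rmorphM /= => /eqP.
by rewrite mulf_eq0 => /orP[]/eqP; [left | right].
Qed.

Lemma nJ_xa : ~ J a.
Proof.
rewrite -curve_idealE => a0; have /eqP : param a = 0 by [].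
by rewrite paramX -size_poly_eq0 size_polyXn.
Qed.

End Curve.

(** * The Hilbert-Samuel function and the multiplicity of the curve *)

Section Multiplicity.
Variables (k : fieldType) (m : nat).
Hypothesis m_gt0 : (1 <= m)%N.
Hypothesis m_coprime : coprime 3 m.
Local Notation T := {mpoly k[3]}.
Local Notation J := (curveJ (xa k) (xb k) (xc k) (xa k ^+ m)).
Local Notation phi := (@param k m).
Local Notation nfdeg := (nfdeg m).
Local Notation M := (vars_ideal k 3).

Lemma colength_eq (A : comNzRingType) (I : set A) l :
  has_chain I l -> (forall l', has_chain I l' -> (l' <= l)%N) -> colength I = l.
Proof.
move=> cl ub; apply: xget_unique => // l' [cl' ub'].
by apply/eqP; rewrite eqn_leq ub // ub'.
Qed.

(* The monomials nfmon j form a basis of T / J, and filt l is spanned modulo J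
   by those with l <= j. *)
Definition filt (l : nat) : set T :=
  [set f | forall j, (j < l)%N -> (phi f)`_(nfdeg j) = 0].

Lemma nfmon_wt j : (nfmon j i0 * 3 + nfmon j i1 + 2 * nfmon j i2 = j)%N.
Proof. by rewrite /nfmon !mon3E; lia. Qed.

(** Multiplying by a variable does not lower the index: a monomial of [f] that contributes in weight
    [nfdeg j] has index at most [j]. *)
Lemma filt_mulX l i f : filt l f -> filt l ('X_i * f).
Proof.
move=> lf j jl; have -> : phi ('X_i * f) = 'X^(wts m i) * phi f.
  by rewrite /param rmorphM /= mmapX mmap1U.
rewrite coefXnM; case: ltnP => // wj; rewrite coef_param big_seq_cond.
have [/hasP[u uf /eqP uj]|/hasPn nu] :=
  boolP (has (fun u => wdeg (wts m) u == nfdeg j - wts m i)%N (msupp f)); last first.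
  by rewrite big_pred0 // => u; case uf: (u \in _) => //=; apply/negbTE/nu.
rewrite -big_seq_cond -coef_param; have [j' [_ _ _ uE]] := wdeg_nf k m u.
rewrite -uj uE; apply: lf; apply: leq_ltn_trans jl.
have [j'' [le _ _ e]] := wdeg_nf k m (U_(i) + nfmon j')%MM.
have <- : j'' = j.
  apply: (nfdeg_inj m_gt0 m_coprime); rewrite -e wdegD wdegU -/(nfdeg j') -uE uj.
  by rewrite subnKC.
by apply: leq_trans le; rewrite -[X in (X <= _)%N](nfmon_wt j') !mnmDE; lia.
Qed.

Lemma paramD : {morph phi : f g / f + g}. Proof. exact: mmapD. Qed.

Lemma is_ideal_filt l : is_ideal (filt l).
Proof.
have fD f g : filt l f -> filt l g -> filt l (f + g).
  by move=> lf lg j jl; rewrite paramD coefD lf // lg // addr0.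
split=> //; first by move=> j _; rewrite /param mmap0 coef0.
move=> x; elim/mpoly_gen_ind: x => [c|i|x y Hx Hy|x y Hx Hy] f lf.
- move=> j jl; rewrite /param rmorphM /= mmapC coefCM.
  by rewrite (lf j jl : (phi f)`_(nfdeg j) = 0) mulr0.
- exact: filt_mulX.
- by rewrite mulrDl; apply: fD; [apply: Hx | apply: Hy].
- by rewrite -mulrA; apply: Hx; apply: Hy.
Qed.

Lemma filt_leq l l' : (l <= l')%N -> filt l' `<=` filt l.
Proof. by move=> ll f lf j jl; apply: lf; apply: leq_trans ll. Qed.

Lemma coef_nfmon i j : (phi 'X_[nfmon i])`_(nfdeg j) = (j == i)%:R.
Proof. by rewrite paramX coefXn (inj_eq (nfdeg_inj m_gt0 m_coprime)). Qed.

Lemma filt_nfmon i : filt i 'X_[nfmon i].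
Proof. by move=> j ji; rewrite coef_nfmon ltn_eqF. Qed.

(** The chain of all [filt i] gives the lower bound. For the upper bound, [V i] collects the leading
    indices below [l] of elements of [c i]; it grows strictly along a strict chain and has at most
    [l] elements. *)
Lemma colength_filt l : colength (filt l) = l.
Proof.
apply: colength_eq.
  exists (fun i => filt (l - i)); split.
  - by move=> i _; apply: is_ideal_filt.
  - by rewrite subn0.
  - move=> i il; rewrite properEneq; split; last by apply: filt_leq; lia.
    apply/eqP => e; have : filt (l - i) 'X_[nfmon (l - i.+1)].
      by rewrite e; apply: filt_nfmon.
    move=> /(_ (l - i.+1)%N); rewrite coef_nfmon eqxx => /(_ _)/eqP.
    by rewrite oner_eq0 => H; have : false by apply: H; lia.
move=> l' [c [c_ideal lc c_strict]].
have c_sub i : (i <= l')%N -> filt l `<=` c i.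
  elim: i => [//|i IH] il f lf; have [+ _] := c_strict i il.
  by apply; apply: IH => //; apply: ltnW.
pose V i := [set j : 'I_l | `[< exists f, [/\ c i f, filt j f & (phi f)`_(nfdeg j) != 0] >] ]%SET.
have V_strict i : (i < l')%N -> V i \proper V i.+1.
  move=> il; have [sub nsub] := c_strict i il.
  have Vsub : V i \subset V i.+1.
    apply/fintype.subsetP=> j; rewrite !finset.in_set => /asboolP[f [cf jf fj]].
    by apply/asboolP; exists f; split=> //; apply: sub.
  rewrite properE Vsub /=; apply/negP => Vsup; apply: nsub.
  (* Elimination: if [c i] and [c i.+1] have the same leading indices, subtracting multiples of
     elements of [c i] raises the leading index until the remainder is in [filt l], which lies in
     [c i]. *)
  suff H n : (n <= l)%N -> filt (l - n) `&` c i.+1 `<=` c i.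
    by move=> f cf; apply: (H l) => //; split=> // j; rewrite subnn.
  elim: n => [_ f [lf _]|n IH nl f [lf cf]].
    by apply: (c_sub i (ltnW il)); rewrite subn0 in lf.
  set j := (l - n.+1)%N in lf; have jl : (j < l)%N by rewrite /j; lia.
  have lE : (l - n = j.+1)%N by rewrite /j; lia.
  rewrite lE in IH.
  have [f0|f0] := eqVneq (phi f)`_(nfdeg j) 0.
    apply: (IH (ltnW nl)); split=> // j'; rewrite ltnS leq_eqVlt => /orP[/eqP-> //|].
    exact: lf.
  have : Ordinal jl \in V i.+1 by rewrite finset.in_set; apply/asboolP; exists f; split.
  move=> /(fintype.subsetP Vsup); rewrite finset.in_set => /asboolP[g /= [cg jg g0]].
  set x := ((phi f)`_(nfdeg j) / (phi g)`_(nfdeg j))%:MP_[3].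
  have [_ ciD ciM] := c_ideal _ (ltnW il).
  rewrite -[f](subrK (x * g)); apply: (ciD); last exact: ciM.
  apply: (IH (ltnW nl)); split; last first.
    have [_ _ cM] := c_ideal _ il.
    by apply: ideal_sub => //; [apply: c_ideal | apply: cM; apply: sub].
  move=> j'; rewrite ltnS /param rmorphB rmorphM /= mmapC coefB coefCM.
  rewrite -/(phi f) -/(phi g) leq_eqVlt => /orP[/eqP->|j'j]; first by rewrite divfK ?subrr.
  by rewrite (lf j' j'j) (jg j' j'j) mulr0 subrr.
have V_card i : (i <= l')%N -> (i <= #|V i|)%N.
  elim: i => [//|i IH] il; apply: leq_ltn_trans (IH (ltnW il)) _.
  exact: proper_card (V_strict i il).
by apply: leq_trans (V_card l' (leqnn _)) _; rewrite -[X in (_ <= X)%N]card_ord max_card.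
Qed.

Lemma ideal_exp_leq (I : set T) n N : (n <= N)%N -> ideal_exp I N `<=` ideal_exp I n.
Proof.
move=> nN; rewrite -(subnK nN); have [_ _ eM] := is_ideal_exp I n.
apply: ideal_gen_min; first exact: is_ideal_exp.
move=> _ [u [Iu ->]]; rewrite big_split_ord; apply: eM; apply: ideal_gen_sub.
by exists (fun i => u (rshift _ i)).
Qed.

Lemma mdeg_ideal_exp n f : ideal_exp M n f -> forall u, f@_u != 0 -> (n <= mdeg u)%N.
Proof.
pose I n := [set f : T | forall u, (mdeg u < n)%N -> f@_u = 0].
have IM i j g h : I i g -> I j h -> I (i + j)%N (g * h).
  move=> Ig Ih u uij; rewrite mcoeffM big1 // => -[v w] /= /eqP/(congr1 (@mdeg 3)).
  rewrite mdegD => uE; have [/Ig ->|iv] := ltnP (mdeg v) i; first by rewrite mul0r.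
  by rewrite Ih ?mulr0 //; lia.
have iI i : is_ideal (I i).
  split=> [u _|g h Ig Ih u ui|g h Ih]; first by rewrite mcoeff0.
    by rewrite mcoeffD Ig // Ih // addr0.
  by rewrite -[i]add0n; apply: IM.
move=> Mf u uf; rewrite leqNgt; apply: contra_neqN uf.
suff: ideal_exp M n `<=` I n by move/(_ f Mf u).
apply: ideal_gen_min => // _ [v [Mv ->]]; elim: n v Mv {Mf} => [|n IH] v Mv.
  by [].
rewrite big_ord_recl; apply: (IM 1%N n); last by apply: IH.
move=> w; rewrite ltnS leqn0 mdeg_eq0 => /eqP ->.
exact/vars_idealP.
Qed.

Lemma nfmon_ideal_exp n j : (3 * n <= j + 2)%N -> ideal_exp M n ('X_[nfmon j] : T).
Proof.
move=> nj; rewrite mpolyX3; have Mv i : M 'X_i by apply: ideal_gen_sub; exists i.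
apply: (@ideal_exp_leq M n (nfmon j i0 + nfmon j i1 + nfmon j i2)%N).
  by rewrite /nfmon !mon3E; lia.
by do 2 ?[apply: ideal_expM]; apply: ideal_expX; apply: (Mv).
Qed.

(** The degree of [nfmon j], j / 3 rounded up, is at least [n] exactly when [j] is at least
    [3 * n - 2]. *)
Lemma add_vars_exp_filt n : (1 <= n)%N ->
  ideal_add J (ideal_exp M n) = filt (3 * n - 2).
Proof.
move=> n_gt0; have [_ aD aM] := is_ideal_gen (J `|` ideal_exp M n).
have aJ f : J f -> ideal_add J (ideal_exp M n) f.
  by move=> Jf; apply: ideal_gen_sub; left.
apply/seteqP; split.
  apply: ideal_gen_min => [|f [Jf|Mf]]; first exact: is_ideal_filt.
    by move=> j _; rewrite param_curveJ // coef0.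
  move=> j jn; rewrite coef_param big1_seq // => u /andP[/eqP uj uf].
  rewrite mcoeff_msupp in uf; have := mdeg_ideal_exp Mf uf.
  have [j' [_ mu _ uE]] := wdeg_nf k m u; rewrite uE in uj.
  by have := nfdeg_inj m_gt0 m_coprime uj; lia.
move=> f ff; have /choice[j jP] := wdeg_nf k m.
rewrite [f]mpolyE (bigID (fun u => j u < 3 * n - 2)%N) /=; apply: (aD); last first.
  apply: ideal_sum => [|u uj]; first exact: is_ideal_gen.
  have [_ _ Ju _] := jP u; rewrite -mul_mpolyC; apply: (aM).
  rewrite -['X_[u]](subrK 'X_[nfmon (j u)]); apply: (aD); first exact: aJ.
  by apply: ideal_gen_sub; right; apply: nfmon_ideal_exp; lia.
apply: aJ; rewrite -(curve_idealE k m_gt0 m_coprime).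
rewrite /curve_ideal /= -/(phi _).
have param_sum : phi (\sum_(u <- msupp f | (j u < 3 * n - 2)%N) f@_u *: 'X_[u])
    = \sum_(u <- msupp f | (j u < 3 * n - 2)%N) f@_u *: 'X^(nfdeg (j u)).
  rewrite /param raddf_sum; apply: eq_bigr => u _ /=.
  rewrite mmapZ -/(phi _) paramX -mul_polyC.
  by have [_ _ _ ->] := jP u.
rewrite param_sum; apply/polyP=> s; rewrite coef0 coef_sum.
have [/hasP[v vf /andP[vn /eqP vs]]|/hasPn nv] :=
    boolP (has (fun v => (j v < 3 * n - 2)%N && (nfdeg (j v) == s)) (msupp f)).
  rewrite -[RHS](ff (j v) vn) coef_param vs [LHS]big_mkcond [RHS]big_mkcond; apply: eq_bigr => u _.
  have [_ _ _ ->] := jP u; rewrite coefZ coefXn eq_sym.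
  case: eqP => [us|]; last by rewrite mulr0 if_same.
  have -> : j u = j v by apply: (nfdeg_inj m_gt0 m_coprime); rewrite us.
  by rewrite vn mulr1.
rewrite big_seq_cond big1 // => u /andP[/nv + un]; rewrite un /= => us.
by rewrite coefZ coefXn eq_sym (negbTE us) mulr0.
Qed.

Lemma hilbert_samuel_curve n : (1 <= n)%N -> hilbert_samuel J n = (3 * n - 2)%N.
Proof. by move=> n1; rewrite /hilbert_samuel add_vars_exp_filt // colength_filt. Qed.

Lemma multiplicity_curve : multiplicity J = 3%N.
Proof.
pose P : {poly rat} := 3 *: 'X - 2%:P.
have PE n : (1 <= n)%N -> P.[n%:R] = (hilbert_samuel J n)%:R.
  move=> n1; rewrite hilbert_samuel_curve // !hornerE natrB ?natrM //; lia.
have sP : size P = 2%N.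
  by rewrite /P size_polyDl size_scale ?size_polyX // size_polyN size_polyC.
have lP : lead_coef P = 3.
  by rewrite lead_coefDl ?lead_coefZ ?lead_coefX ?mulr1 // size_scale // size_polyX
    size_polyN size_polyC.
apply: xget_unique.
  exists P; split; first by exists 1%N.
  by rewrite lP sP /= divr1.
move=> e [Q [[N NQ] lQ]].
have PQ : Q = P.
  apply/eqP; rewrite -subr_eq0; apply/negPn/negP => QP.
  (* The roots are taken beyond [N], shifted by one because the value [3 * n - 2] is valid from
     [n = 1] on. *)
  have := @max_poly_roots _ (Q - P) [seq (N + i.+1)%:R | i <- iota 0 (size (Q - P))] QP.
  rewrite size_map size_iota ltnn => H; suff: false by []; apply: H.
    apply/allP=> _ /mapP[i _ ->]; rewrite rootE hornerD hornerN.
    by rewrite PE ?NQ ?subrr //; lia.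
  rewrite map_inj_uniq ?iota_uniq // => i i' /eqP.
  by rewrite eqr_nat => /eqP; lia.
move: lQ; rewrite PQ lP sP /= divr1 => /eqP; rewrite eqr_nat => /eqP //.
Qed.

End Multiplicity.

(** * The graded resolution of I_n and its regularity *)

Section Resolution.
Variables (k : fieldType) (m : nat).
Hypothesis m_gt0 : (1 <= m)%N.
Hypothesis m_coprime : coprime 3 m.
Local Notation T := {mpoly k[3]}.
Local Notation a := (xa k).
Local Notation b := (xb k).
Local Notation c := (xc k).
Local Notation q := (xa k ^+ m).
Local Notation J := (curveJ a b c q).
Local Notation I := (symb a b c q).
Local Notation M := (vars_ideal k 3).
Local Notation d := (wts m).
Local Notation d2 := (3 + m)%N.
Local Notation d3 := (3 + 2 * m)%N.

Lemma whomog_eq e e' (f : T) : whomog d e f -> e = e' -> whomog d e' f.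
Proof. by move=> ? <-. Qed.

Lemma whomog_a : whomog d 3 a. Proof. exact: whomogX. Qed.
Lemma whomog_b : whomog d d2%:Z b. Proof. exact: whomogX. Qed.
Lemma whomog_c : whomog d d3%:Z c. Proof. exact: whomogX. Qed.
Lemma whomog_q : whomog d (3 * m)%:Z q.
Proof. by apply: whomog_eq (whomogXn (n := m) whomog_a) _; rewrite -mulr_natr; lia. Qed.

Lemma whomog_cf1 : whomog d (2 * d2)%:Z (cf1 a b c).
Proof.
rewrite /cf1 expr2; apply: whomogB; first by apply: whomog_eq (whomogM whomog_b whomog_b) _; lia.
by apply: whomog_eq (whomogM whomog_a whomog_c) _; lia.
Qed.

Lemma whomog_cf2 : whomog d (d2 + d3)%:Z (cf2 a b c q).
Proof.
rewrite /cf2 expr2; apply: whomogB; first by apply: whomog_eq (whomogM whomog_b whomog_c) _; lia.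
by apply: whomog_eq (whomogM (whomogM whomog_a whomog_a) whomog_q) _; lia.
Qed.

Lemma whomog_cf3 : whomog d (2 * d3)%:Z (cf3 a b c q).
Proof.
rewrite /cf3 expr2; apply: whomogB; first by apply: whomog_eq (whomogM whomog_c whomog_c) _; lia.
by apply: whomog_eq (whomogM (whomogM whomog_a whomog_b) whomog_q) _; lia.
Qed.

Lemma whomog_Delta : whomog d (3 * d3)%:Z (Delta a b c q).
Proof.
rewrite DeltaE; apply: whomogD; first apply: whomogB.
- by apply: whomog_eq (whomogM (whomogM whomog_q whomog_b) whomog_cf1) _; lia.
- by apply: whomog_eq (whomogM (whomogM whomog_a whomog_q) whomog_cf2) _; lia.
- by apply: whomog_eq (whomogM whomog_c whomog_cf3) _; lia.
Qed.

Definition curve_gdeg (i : 'I_3) : nat := nth 0%N [:: 2 * d2; d2 + d3; 2 * d3]%N i.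
(** The third entry is the weight of [Delta]; it belongs to the bordering row and occurs from the
    second power on. *)
Definition curve_rdeg (i : nat) : nat := nth 0%N [:: 2 * d2 + d3; d2 + 2 * d3; 3 * d3]%N i.

Fixpoint gdeg n : 'I_(ngens n) -> nat :=
  match n with
  | 0 => fun=> 0%N
  | 1 => curve_gdeg
  | n'.+2 => fun i => match split (i : 'I_(3 + ngens n')) with
      | inl j => (2 * d2 * n'.+1 + curve_gdeg j)%N
      | inr j => (3 * d3 + gdeg j)%N
      end
  end.

Fixpoint rdeg n : 'I_(nrels n) -> nat :=
  match n with
  | 0 => fun=> 0%N
  | 1 => fun i => curve_rdeg i
  | n'.+2 => fun i => match split (i : 'I_(3 + nrels n')) with
      | inl j => (2 * d2 * n'.+1 + curve_rdeg j)%N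
      | inr j => (3 * d3 + rdeg j)%N
      end
  end.

Lemma curve_gens_graded i : whomog d (curve_gdeg i)%:Z (curve_gens a b c q i 0).
Proof.
rewrite mxE; case: i => [[|[|[|//]]] lt] /=;
  [exact: whomog_cf1 | exact: whomog_cf2 | exact: whomog_cf3].
Qed.

Lemma gens_graded n i : whomog d (@gdeg n i)%:Z (gens a b c q n i 0).
Proof.
elim/nat_ind2: n i => [i|i|n IH i].
- by rewrite mxE; apply: whomog1.
- exact: curve_gens_graded.
rewrite /= mxE; case: split => j; rewrite mxE.
  apply: whomog_eq (whomogM (whomogXn (n := n.+1) whomog_cf1) (@curve_gens_graded j)) _.
  by rewrite -mulr_natr; lia.
by apply: whomog_eq (whomogM whomog_Delta (IH j)) _; lia.
Qed.

Lemma cf1X_coord_graded n j :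
  whomog d ((2 * d2 * n)%:Z - (@gdeg n j)%:Z) (cf1X_coord T n 0 j).
Proof.
have delta (i : 'I_3) l : l = 2 * d2%:Z ->
    whomog d (l - (curve_gdeg i)%:Z) ((delta_mx 0 0 : 'rV[T]_3) 0 i).
  move=> ->; rewrite mxE /=; case: eqP => [->|_]; last exact: whomog0.
  by apply: whomog_eq (@whomog1 k 3 d) _; rewrite /curve_gdeg /=; lia.
case: n j => [|[|n]] j; first by rewrite mxE muln0 subrr; apply: whomog1.
  by apply: delta; lia.
rewrite /= mxE; case: split => l; last by rewrite mxE; apply: whomog0.
by apply: whomog_eq (delta l _ erefl) _; lia.
Qed.

Lemma curve_rels_Delta_graded (i j : 'I_3) :
  whomog d ((curve_rdeg i)%:Z - (curve_gdeg j)%:Z) (curve_rels_Delta a b c q i j).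
Proof.
have aq := whomogM whomog_a whomog_q; have qb := whomogM whomog_q whomog_b.
rewrite mxE; case: i => [[|[|[|//]]] lt]; case: j => [[|[|[|//]]] lt'] /=;
  rewrite /curve_rdeg /curve_gdeg /= ?mul1r; try apply: whomogN;
  first [ by apply: whomog_eq whomog_a _; lia | by apply: whomog_eq whomog_b _; lia
        | by apply: whomog_eq whomog_c _; lia | by apply: whomog_eq aq _; lia
        | by apply: whomog_eq qb _; lia ].
Qed.

Lemma rels_graded n i j :
  whomog d ((@rdeg n i)%:Z - (@gdeg n j)%:Z) (rels a b c q n i j).
Proof.
elim/nat_ind2: n i j => [[]//|i j|n IH i j].
  have := @curve_rels_Delta_graded (widen_ord (isT : (2 <= 3)%N) i) j.
  by rewrite !mxE /=; case: i => [[|[|//]] lt].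
rewrite /= mxE; case: split => i'; rewrite mxE; case: split => j'.
- by apply: whomog_eq (@curve_rels_Delta_graded i' j') _; lia.
- rewrite mxE; apply: whomogN; case: eqP => [i2|_]; last by rewrite !mul0r; apply: whomog0.
  rewrite mul1r; apply: whomog_eq (whomogM whomog_cf1 (@cf1X_coord_graded _ j')) _.
  by rewrite i2 /curve_rdeg /=; lia.
- by rewrite mxE; apply: whomog0.
- by apply: whomog_eq (IH i' j') _; lia.
Qed.

Lemma M_mulr (f g : T) : M g -> M (f * g).
Proof. by have [_ _] := is_ideal_gen (range (fun i : 'I_3 => 'X_i : T)); apply. Qed.

Lemma M_mull (f g : T) : M f -> M (f * g).
Proof. by rewrite mulrC; apply: M_mulr. Qed.

Lemma M_X i : M 'X_i. Proof. by apply: ideal_gen_sub; exists i. Qed.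

Lemma M_opp (f : T) : M f -> M (- f).
Proof. by apply: (@ideal_opp _ M); apply: is_ideal_gen. Qed.

Lemma M_0 : M 0. Proof. by have [] := is_ideal_gen (range (fun i : 'I_3 => 'X_i : T)). Qed.

Lemma M_gens i : M (curve_gens a b c q i 0).
Proof.
rewrite mxE; case: i => [[|[|[|//]]] lt] /=; rewrite /cf1 /cf2 /cf3 !expr2;
  apply: (@ideal_sub _ M); first [exact: is_ideal_gen | by apply: M_mull; exact: M_X
    | by apply: M_mull; apply: M_mull; exact: M_X].
Qed.

Lemma M_cf1 : M (cf1 a b c). Proof. by have := @M_gens ord0; rewrite mxE. Qed.

Lemma curveJ_M f : J f -> M f.
Proof.
have [_ MD _] := is_ideal_gen (range (fun i : 'I_3 => 'X_i : T)).
have M1 := @M_gens i0; have M2 := @M_gens i1; have M3 := @M_gens i2.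
rewrite !mxE /= in M1 M2 M3.
by case=> x [y [z ->]]; do 2 ?[apply: (MD)]; apply: M_mulr.
Qed.

Lemma gens_minimal n i : (0 < n)%N -> M (gens a b c q n i 0).
Proof.
case: n i => [//|[|n]] i _; first exact: M_gens.
rewrite /= mxE; case: split => j; rewrite mxE; first by apply: M_mulr; exact: M_gens.
by apply: M_mull; apply: curveJ_M; apply: curveJ_Delta.
Qed.

Lemma curve_rels_Delta_minimal i j : M (curve_rels_Delta a b c q i j).
Proof.
rewrite mxE; case: i => [[|[|[|//]]] lt]; case: j => [[|[|[|//]]] lt'] /=;
  try apply: M_opp; first [exact: M_X | by apply: M_mull; exact: M_X | by apply: M_mulr; exact: M_X].
Qed.

Lemma rels_minimal n i j : M (rels a b c q n i j).
Proof.
elim/nat_ind2: n i j => [[]//|i j|n IH i j].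
  have := @curve_rels_Delta_minimal (widen_ord (isT : (2 <= 3)%N) i) j.
  by rewrite !mxE /=; case: i => [[|[|//]] lt].
rewrite /= mxE; case: split => i'; rewrite mxE; case: split => j'.
- exact: curve_rels_Delta_minimal.
- by rewrite mxE; apply: M_opp; apply: M_mull; apply: M_mulr; apply: M_cf1.
- by rewrite mxE; apply: M_0.
- exact: IH.
Qed.

Definition quot_rank n i : nat :=
  match i with 0 => 1 | 1 => ngens n | 2 => nrels n | _ => 0 end.

Definition quot_twist n i : 'I_(quot_rank n i) -> int :=
  match i return 'I_(quot_rank n i) -> int with
  | 0 => fun=> 0
  | 1 => fun j => (gdeg j)%:Z
  | 2 => fun j => (rdeg j)%:Z
  | _ => fun=> 0
  end.

Definition quot_diff n i : 'M[T]_(quot_rank n i.+1, quot_rank n i) :=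
  match i return 'M[T]_(quot_rank n i.+1, quot_rank n i) with
  | 0 => gens a b c q n
  | 1 => rels a b c q n
  | _ => 0
  end.

Definition quot_complex n : free_complex k 3 :=
  @FreeComplex k 3 (quot_rank n) (@quot_twist n) (quot_diff n) (fun=> 1).

Definition ideal_complex n : free_complex k 3 :=
  @FreeComplex k 3 (fun i => quot_rank n i.+1) (fun i => @quot_twist n i.+1)
    (fun i => quot_diff n i.+1) (fun j => gens a b c q n j 0).

Lemma quot_diff_graded n i x y :
  whomog d (quot_twist x - quot_twist y) (quot_diff n i x y).
Proof.
case: i x y => [|[|i]] x y.
- by rewrite (ord1 y) subr0; apply: gens_graded.
- exact: rels_graded.
- by case: x.
Qed.

Lemma quot_exact n i (v : 'rV_(quot_rank n i.+1)) :
  v *m quot_diff n i = 0 <-> exists w, v = w *m quot_diff n i.+1.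
Proof.
case: i v => [|[|i]] v.
- split=> [v0|[w ->]].
    apply: (geval_eq0 (@f1_prime k) (@f1_neq0 k) (@f1_ndvd_f2 k m) (@xab_regular k)).
    by rewrite /geval [v *m _]v0 mxE.
  by apply/rowP=> j; rewrite ord1 [RHS]mxE; exact: geval_rels.
- split=> [/(rels_inj (@f1_prime k) (@f1_neq0 k) (@f1_ndvd_f2 k m)) v0|[w ->]].
    by exists 0; rewrite v0 mul0mx.
  by rewrite /= mulmx0 mul0mx.
- split=> _; last exact: mulmx0.
  by exists 0; apply/rowP=> -[x lt]; have : (x < 0)%N := lt.
Qed.

Lemma quot_diff_minimal n i x y : (0 < n)%N -> M (quot_diff n i x y).
Proof.
case: i x y => [|[|i]] x y n_gt0.
- by rewrite (ord1 y); apply: gens_minimal.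
- exact: rels_minimal.
- by case: x.
Qed.

Lemma quot_complex_res n : (0 < n)%N ->
  minimal_graded_free_resolution d (quot_complex n) setT (I n).
Proof.
move=> n_gt0; have [I0 ID IM] := is_ideal_symb a b c q n.
have epsE v : @fc_eps _ _ (quot_complex n) v = v 0 0.
  by rewrite /fc_eps big_ord1 /= mulr1.
split.
- split; last exact: quot_diff_graded.
  by move=> j; apply: whomog1.
- split=> //; last exact: quot_exact.
    by move=> f _; exists (const_mx f); rewrite epsE mxE subrr.
  move=> v; rewrite epsE; split=> [/symb_gevalP[w wE]|[w wE]].
    by exists w; apply/rowP=> j; rewrite ord1 wE.
  by apply/symb_gevalP; exists w; rewrite wE.
- by move=> i x y; apply: quot_diff_minimal.
Qed.

Lemma ideal_complex_res n : (0 < n)%N ->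
  minimal_graded_free_resolution d (ideal_complex n) (I n) [set 0].
Proof.
move=> n_gt0.
have epsE v : @fc_eps _ _ (ideal_complex n) v = @geval _ a b c q n v.
  by rewrite /geval mxE.
split.
- split; last by move=> i; apply: quot_diff_graded.
  exact: gens_graded.
- split=> [j|f /symb_gevalP[v ->]|v|i v]; last exact: quot_exact.
  + apply/symb_gevalP; exists (delta_mx 0 j).
    by rewrite /geval -rowE [RHS]mxE.
  + by exists v; rewrite epsE subrr.
  rewrite epsE -(quot_exact (i := 0) v) /=; split=> [v0|v0].
    by apply/rowP=> j; rewrite ord1 [RHS]mxE.
  by rewrite /geval v0 mxE.
- by move=> i x y; apply: quot_diff_minimal.
Qed.

Lemma symb_homog n : homog_ideal d (I n).
Proof.
move=> e f /symb_gevalP[v ->]; rewrite /geval mxE hpart_sum.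
apply: ideal_sum => [|j _]; first exact: is_ideal_symb.
rewrite (hpartM _ _ (@gens_graded n j)); have [_ _ IM] := is_ideal_symb a b c q n.
apply: IM; apply/symb_gevalP; exists (delta_mx 0 j).
by rewrite /geval -rowE mxE.
Qed.

(** As [d2 < d3], the third row has the largest degree among the new relations,
    [2 * d2 * n'.+1 + 3 * d3]. *)
Fixpoint max_rdeg (n : nat) : nat :=
  match n with
  | 0 => 0
  | 1 => d2 + 2 * d3
  | n'.+2 => 3 * d3 + maxn (2 * d2 * n'.+1) (max_rdeg n')
  end.

Lemma rdeg_max n (i : 'I_(nrels n)) : (rdeg i <= max_rdeg n)%N.
Proof.
elim/nat_ind2: n i => [[]//|i|n IH i] /=.
  by case: i => [[|[|//]] lt]; rewrite /curve_rdeg /=; lia.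
case: split => j; last by have := IH j; lia.
by case: j => [[|[|[|//]]] lt]; rewrite /curve_rdeg /=; lia.
Qed.

Lemma rdeg_max_ex n : (0 < n)%N -> exists i : 'I_(nrels n), rdeg i = max_rdeg n.
Proof.
elim/nat_ind2: n => [//|_|n IH _]; first by exists (@Ordinal 2 1 isT).
have [le|lt] := leqP (max_rdeg n) (2 * d2 * n.+1).
  exists (lshift (nrels n) (@Ordinal 3 2 isT)) => /=.
  by rewrite (unsplitK (inl _ : 'I_3 + 'I_(nrels n))) /curve_rdeg /=; lia.
have n_gt0 : (0 < n)%N by case: n lt {IH}.
have [i iE] := IH n_gt0; exists (rshift 3 i) => /=.
by rewrite (unsplitK (inr _ : 'I_3 + 'I_(nrels n))) iE; lia.
Qed.

(** The extra 1 makes up for the homological shift: [gdeg i - 1] must not exceed [max_rdeg n - 2],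
    so that the relations alone determine the regularity. *)
Lemma gdeg_max n (i : 'I_(ngens n)) : (gdeg i + (0 < n) <= max_rdeg n)%N.
Proof.
elim/nat_ind2: n i => [//|i|n IH i] /=.
  by case: i => [[|[|[|//]]] lt]; rewrite /curve_gdeg /=; lia.
case: split => j.
  by case: j => [[|[|[|//]]] lt]; rewrite /curve_gdeg /=; lia.
have n0 : n = 0%N -> max_rdeg n = 0%N by move=> ->.
have := IH j; have : (0 < 2 * d2 * n.+1)%N by [].
move: (2 * d2 * n.+1)%N => x; case: (posnP n) => [/n0|]; lia.
Qed.

Lemma max_rdeg_ge2 n : (0 < n)%N -> (2 <= max_rdeg n)%N.
Proof. by case: n => [|[|n]] //= _; lia. Qed.

Lemma reg_quotient_symb n : (0 < n)%N ->
  reg_quotient d (I n) = (max_rdeg n)%:Z - 2.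
Proof.
move=> n_gt0; apply: (regularity_eq (is_ideal_symb a b c q n) (@symb_homog n)
  (quot_complex_res n_gt0)).
  by have [i iE] := rdeg_max_ex n_gt0; exists 2%N, i; rewrite /= iE.
case=> [|[|[|i]]] j /=.
- by have := max_rdeg_ge2 n_gt0; lia.
- by have := gdeg_max j; rewrite n_gt0; lia.
- by have := rdeg_max j; lia.
- by case: j.
Qed.

Lemma reg_ideal_symb n : (0 < n)%N -> reg_ideal d (I n) = (max_rdeg n)%:Z - 1.
Proof.
move=> n_gt0; apply: (regularity_eq _ _ (ideal_complex_res n_gt0)).
- split=> [//|f g -> ->|f g ->]; [exact: addr0 | exact: mulr0].
- by move=> e f ->; apply: hpart0.
- by have [i iE] := rdeg_max_ex n_gt0; exists 1%N, i; rewrite /= iE.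
case=> [|[|i]] j /=.
- by have := gdeg_max j; rewrite n_gt0; lia.
- by have := rdeg_max j; lia.
- by case: j.
Qed.

End Resolution.

(** * Solving the recursion for the top degree *)

Section ClosedForms.
Variable m : nat.
Local Notation d2 := (3 + m)%N.
Local Notation d3 := (3 + 2 * m)%N.

Lemma max_rdegSS n :
  max_rdeg m n.+2 = (3 * d3 + maxn (2 * d2 * n.+1) (max_rdeg m n))%N.
Proof. by []. Qed.

(** With d2 = 4 and d3 = 5, the new term 8 (n + 1) always wins: from n = 2 on it exceeds the old
    value 8 n + 7 by one. *)
Lemma max_rdeg_m1 n : m = 1%N -> max_rdeg m n.+2 = (8 * n.+2 + 7)%N.
Proof. by move=> mE; elim/nat_ind2: n => [||n IH]; rewrite max_rdegSS ?IH mE //; lia. Qed.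

(** The new term supplies [2 * d2] at the second power; afterwards the old one wins, because
    [4 * d2 <= 3 * d3]. *)
Lemma max_rdeg_even h : (2 <= m)%N -> max_rdeg m (2 * h.+1) = (3 * d3 * h.+1 + 2 * d2)%N.
Proof.
move=> m2; elim: h => [|h IH]; first by rewrite muln1 /=; lia.
rewrite (_ : 2 * h.+2 = (2 * h.+1).+2)%N; last by lia.
rewrite max_rdegSS IH (maxn_idPr _); first by nia.
have : (4 * d2 * h.+1 <= 3 * d3 * h.+1)%N by rewrite leq_mul2r; lia.
by nia.
Qed.

(** With d2 = 5 and d3 = 7, the new term 4 d2 = 20 beats the top degree 19 of the first power once,
    at the third power; afterwards the old term wins. *)
Lemma max_rdeg_odd2 h : m = 2%N -> max_rdeg m (2 * h.+1).+1 = (21 * h.+1 + 20)%N.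
Proof.
move=> mE; elim: h => [|h IH]; first by rewrite !max_rdegSS mE.
rewrite (_ : (2 * h.+2).+1 = (2 * h.+1).+3)%N; last by lia.
by rewrite max_rdegSS IH mE; lia.
Qed.

(** Already at the third power [4 * d2 <= d2 + 2 * d3], so the old term always wins. *)
Lemma max_rdeg_odd3 h : (3 <= m)%N -> max_rdeg m (2 * h).+1 = (3 * d3 * h + d2 + 2 * d3)%N.
Proof.
move=> m3; elim: h => [|h IH]; first by rewrite muln0 /=; lia.
rewrite (_ : (2 * h.+1).+1 = (2 * h).+3)%N; last by lia.
rewrite max_rdegSS IH (maxn_idPr _); first by nia.
have : (4 * d2 * h <= 3 * d3 * h)%N by rewrite leq_mul2r; lia.
by nia.
Qed.

(** Any bound independent of [n] gives the limit; [100 * d3] is a generous choice. *)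
Lemma max_rdeg_asymp n : (2 <= m)%N -> (2 <= n)%N ->
  (3 * d3 * n <= 2 * max_rdeg m n <= 3 * d3 * n + 100 * d3)%N.
Proof.
move=> m2 n2; have [h [nE|nE]] : exists h, (n = 2 * h.+1 \/ n = (2 * h.+1).+1)%N.
  by exists (n./2.-1)%N; lia.
  by rewrite nE max_rdeg_even //; apply/andP; split; nia.
have [m3|m3] := leqP 3 m; last first.
  have mE : m = 2%N by lia.
  by rewrite nE max_rdeg_odd2 // mE; apply/andP; split; lia.
by rewrite nE max_rdeg_odd3 //; apply/andP; split; nia.
Qed.

End ClosedForms.

(** * The limit and the final statement *)

Lemma cvg_ratio (R : realType) (u : nat -> R) (l C : R) :
  (forall n, (2 <= n)%N -> `|l * n%:R - u n| <= C) ->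
  (u n / n%:R) @[n --> \oo] --> l.
Proof.
move=> uC; have C0 : 0 <= C by apply: le_trans (uC 2%N isT).
apply/cvgrPdist_lt => e e0; exists (2 + Num.truncn (C / e)).+1 => // n /= Nn.
have n2 : (2 <= n)%N by lia.
have n0 : 0 < n%:R :> R by rewrite ltr0n; lia.
rewrite -[l](mulfK (lt0r_neq0 n0)) -mulrBl normrM normfV (gtr0_norm n0).
rewrite ltr_pdivrMr //; apply: le_lt_trans (uC n n2) _.
rewrite mulrC -ltr_pdivrMr //; apply: lt_le_trans (truncnS_gt _) _.
by rewrite ler_nat; apply: leq_trans Nn; rewrite ltnS leq_addl.
Qed.

Theorem theorem7p18 (k : fieldType) (R : realType) (m : nat)
    (hm : (1 <= m)%N) (hm3 : coprime 3 m) :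
  let d1 := 3%N in
  let d2 := (3 + m)%N in
  let d3 := (3 + 2 * m)%N in
  let d : 'I_3 -> nat := tnth [tuple d1; d2; d3] in
  let p : set {mpoly k[3]} := curve_ideal k d in
  let reg_symb (n : nat) : rat := (reg_quotient d (symbolic_power p n))%:~R in
  let reg_sat (n : nat) : R :=
    (reg_ideal d (saturation (ideal_exp p n) (vars_ideal k 3)))%:~R in
  [/\ reg_quotient d p = d2%:Z + 2 * d3%:Z - 2,
      forall n : nat, (2 <= n)%N ->
        [/\ m = 1%N ->
              reg_symb n = 2 * d2%:R * n%:R - 2 * d2%:R + 3 * d3%:R - 2,
            m = 2%N ->
              (odd n -> reg_symb n =
                 3 * d3%:R / 2 * n%:R + 4 * d2%:R - 3 * d3%:R / 2 - 2) /\
              (~~ odd n -> reg_symb n =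
                 3 * d3%:R / 2 * n%:R + 2 * d2%:R - 2)
          & (3 <= m)%N ->
              (odd n -> reg_symb n =
                 3 * d3%:R / 2 * n%:R + d2%:R + d3%:R / 2 - 2) /\
              (~~ odd n -> reg_symb n =
                 3 * d3%:R / 2 * n%:R + 2 * d2%:R - 2)],
      (2 <= m)%N ->
        (reg_sat n / n%:R) @[n --> \oo] -->
          (3 * (multiplicity p)%:R / 2 + 3 * m%:R : R)
    & m = 1%N ->
        (reg_sat n / n%:R) @[n --> \oo] --> (2 * d2%:R : R)].

Proof.
move=> d1 d2 d3 d p reg_symb reg_sat.
have pE : p = curveJ (xa k) (xb k) (xc k) (xa k ^+ m) by apply: curve_idealE.
have symbE n : symbolic_power p n = symb (xa k) (xb k) (xc k) (xa k ^+ m) n.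
  rewrite pE; apply: symbolic_power_symb;
    [exact: f1_prime | exact: f1_neq0 | exact: f1_ndvd_f2 | exact: xab_regular
    | exact: xabc_regular | exact: curveJ_prime | exact: nJ_xa].
have satE n : saturation (ideal_exp p n) (vars_ideal k 3)
    = symb (xa k) (xb k) (xc k) (xa k ^+ m) n.
  rewrite pE; apply: saturation_symb;
    [exact: f1_prime | exact: f1_neq0 | exact: f1_ndvd_f2 | exact: xab_regular
    | exact: xabc_regular | exact: curveJ_prime | exact: nJ_xa | exact: vars_ideal3P].
have rsE n : (2 <= n)%N -> reg_symb n = (max_rdeg m n)%:R - 2.
  move=> n2; rewrite /reg_symb symbE (_ : reg_quotient _ _ = (max_rdeg m n)%:Z - 2).
    by rewrite rmorphB /= -!pmulrn.
  by apply: reg_quotient_symb => //; lia.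
have rtE n : (2 <= n)%N -> reg_sat n = (max_rdeg m n)%:R - 1.
  move=> n2; rewrite /reg_sat satE (_ : reg_ideal _ _ = (max_rdeg m n)%:Z - 1).
    by rewrite rmorphB /= -!pmulrn.
  by apply: reg_ideal_symb => //; lia.
have half n : (2 <= n)%N -> odd n -> exists h, n = (2 * h.+1).+1.
  by move=> n2 on; exists (n./2.-1)%N; lia.
have halfe n : (2 <= n)%N -> ~~ odd n -> exists h, n = (2 * h.+1)%N.
  by move=> n2 on; exists (n./2.-1)%N; lia.
have oddE h : (2 * h.+1).+1%:R = 2 * h.+1%:R + 1 :> rat by rewrite -natr1 natrM.
split.
- rewrite pE (reg_quotient_symb k hm hm3 (isT : (0 < 1)%N)) /= /d2 /d3; lia.
- move=> n n2; rewrite !rsE //; split=> [m1|m2|m3].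
  + case: n n2 => [|[|n]] // _; rewrite max_rdeg_m1 // /d2 /d3 m1 !(natrM, natrD); ring.
  + split=> [/(half n n2)|/(halfe n n2)] [h ->].
      by rewrite max_rdeg_odd2 // /d2 /d3 m2 oddE !(natrM, natrD); field.
    by rewrite max_rdeg_even ?(eq_leq (esym m2)) // /d2 /d3 !(natrM, natrD); field.
  + split=> [/(half n n2)|/(halfe n n2)] [h ->].
      by rewrite max_rdeg_odd3 // /d2 /d3 oddE !(natrM, natrD); field.
    by rewrite max_rdeg_even ?(ltnW m3) // /d2 /d3 !(natrM, natrD); field.
- move=> m2; rewrite pE multiplicity_curve //.
  (* Since d3 = 3 + 2 m, the claimed limit is 3 d3 / 2, the slope found in [max_rdeg_asymp]. *)
  have close n : (2 <= n)%N ->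
      `|(3 * 3 / 2 + 3 * m%:R) * n%:R - reg_sat n| <= 100 * d3%:R + 2 :> R.
    move=> n2; rewrite rtE //; have /andP[] := max_rdeg_asymp m2 n2.
    rewrite -!(ler_nat R) !(natrM, natrD) => lo hi.
    by have m0 := ler0n R m; rewrite ler_norml; apply/andP; split; lra.
  exact: cvg_ratio close.
(* Here [reg_sat n] is 8 n + 6, at constant distance 6 from [2 * d2 * n]. *)
- move=> m1; apply: (@cvg_ratio _ _ _ 100) => n n2; rewrite rtE //.
  case: n n2 => [|[|n]] // _; rewrite max_rdeg_m1 // /d2 m1 !(natrM, natrD).
  rewrite (_ : _ - _ = -6); first by rewrite normrN ger0_norm ?ler_nat.
  ring.
Qed.
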